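(* Fix a realization of the coefficient $A$. Assume that the exact preconditioned operator $\mathcal P:V_h\to V_h$ satisfies, for constants $C_1,C_2>0$, $$C_1\|v\|_a^2\le a(\mathcal P v,v)\le C_2\|v\|_a^2\qquad\forall v\in V_h,$$ and that the perturbation constant $$\eta:=\sup_{v\in V_h\setminus\{0\}}\frac{|a((\widetilde{\mathcal P}-\mathcal P)v,v)|}{\|v\|_a^2}$$ satisfies $\eta<C_1$. Then the offline-online preconditioned operator $\widetilde{\mathcal P}$ satisfies $$(C_1-\eta)\|v\|_a^2\le a(\widetilde{\mathcal P}v,v)\le (C_2+\eta)\|v\|_a^2\qquad\forall v\in V_h.$$ In particular, the spectrum of $\widetilde{\mathcal P}$ is contained in the interval $[C_1-\eta,\,C_2+\eta]$. Consequently, the condition number of $\widetilde{\mathcal P}=\widetilde{\mathcal B}\circ\mathcal L$ satisfies $$\kappa(\widetilde{\mathcal P})\le\frac{C_2+\eta}{C_1-\eta}.$$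
   Context: Domain and spaces. $\Omega\subset\mathbb R^d$, $d\in\{1,2,3\}$, is the unit hypercube, with nested uniform Cartesian meshes $\mathcal T_h$ (fine) and $\mathcal T_H$ (coarse), $H>h$, where $\mathcal T_h$ is a refinement of $\mathcal T_H$. $V_h\subset H_0^1(\Omega)$ is the conforming $Q_1$ finite element space (continuous, piecewise multilinear) on $\mathcal T_h$ and $V_H\subset V_h$ the corresponding space on $\mathcal T_H$. $V_h'$ is the dual of $V_h$ with pairing $\langle\cdot,\cdot\rangle$. Let $\{\varphi_i\}_{i\in\mathcal N}$, $\mathcal N=\{1,\dots,|\mathcal N|\}$, be the nodal basis of $V_H$ (one function per interior coarse vertex). The patches are $\omega_i=\operatorname{supp}\varphi_i$ and the local spaces are $V_i=V_h\cap H_0^1(\omega_i)$ for $i\in\mathcal N$ (functions extended by zero), and $V_0:=V_H$. All patches are translates of one reference patch $\widehat\omega$. Coefficient. Let $\varepsilon$ satisfy $h\le\varepsilon<H$. Let $A_\varepsilon(x)=A_{\rm per}(x/\varepsilon)$, $B_\varepsilon(x)=B_{\rm per}(x/\varepsilon)$ with scalar $1$-periodic $A_{\rm per},B_{\rm per}$ such that both $A_{\rm per}$ and $A_{\rm per}+B_{\rm per}$ take values in $[\alpha,\beta]$ a.e., with $0<\alpha\le\beta<\infty$. Let $\mathcal Q\subset[0,1]^d$ be the reference defect cell and $I=\{j\in\mathbb Z^d:\varepsilon(j+\mathcal Q)\subset\Omega\}$. A realization of the coefficient is $A=A_\varepsilon+\sum_{j\in I}\hat b^j\chi_{\varepsilon(j+\mathcal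 Q)}B_\varepsilon$ with $\hat b^j\in\{0,1\}$ (realizations of independent Bernoulli variables), and $\alpha\le A\le\beta$ a.e. The coarse mesh is aligned with the periodicity: the restrictions $A_\varepsilon|_T$ are identical (up to translation) for all $T\in\mathcal T_H$. Bilinear form. $a(u,v)=\int_\Omega A\nabla u\cdot\nabla v\,dx$, $\|v\|_a=a(v,v)^{1/2}$, and $\mathcal L:V_h\to V_h'$ is defined by $\langle\mathcal L v,w\rangle=a(v,w)$ for all $v,w\in V_h$. Exact preconditioner. For $i=0,\dots,|\mathcal N|$, $\mathcal B_i:V_h'\to V_i$ is defined by $a(\mathcal B_i g,w)=\langle g,w\rangle$ for all $w\in V_i$. Set $\mathcal P_i=\mathcal B_i\circ\mathcal L$, $\mathcal B=\sum_{i=0}^{|\mathcal N|}\mathcal B_i$, $\mathcal P=\mathcal B\circ\mathcal L=\sum_{i=0}^{|\mathcal N|}\mathcal P_i$. Offline-online preconditioner. The reference coefficients on $\widehat\omega$ are $A^{(0)}=A_\varepsilon|_{\widehat\omega}$ and $A^{(\ell)}=A_\varepsilon|_{\widehat\omega}+\chi_{\varepsilon(j_\ell+\mathcal Q)}B_\varepsilon$ for $\ell=1,\dots,N_{\rm ref}$, where $j_\ell$ enumerates the possible defect positions in $\widehat\omega$; they are transferred to each patch $\omega_i$ by translation (same notation). On each patch the realization is represented as $A|_{\omega_i}=\sum_{\ell=0}^{N_{\rm ref}}\mu_\ell^{(i)}A^{(\ell)}$, where for $\ell\ge1$ $\mu_\ell^{(i)}\in\{0,1\}$ indicates whether a defect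 is present at location $\ell$ in $\omega_i$, and $\mu_0^{(i)}=1-\sum_{\ell\ge1}\mu_\ell^{(i)}$, so $\sum_{\ell=0}^{N_{\rm ref}}\mu^{(i)}_\ell=1$. For $i\in\mathcal N$, $\mathcal B_i^{(\ell)}:V_h'\to V_i$ is defined by $\int_{\omega_i}A^{(\ell)}\nabla(\mathcal B_i^{(\ell)}g)\cdot\nabla w\,dx=\langle g,w\rangle$ for all $w\in V_i$. Set $\widetilde{\mathcal B}_i=\sum_{\ell=0}^{N_{\rm ref}}\mu_\ell^{(i)}\mathcal B_i^{(\ell)}$ for $i\in\mathcal N$, $\widetilde{\mathcal B}=\mathcal B_0+\sum_{i\ge1}\widetilde{\mathcal B}_i$ and $\widetilde{\mathcal P}=\widetilde{\mathcal B}\circ\mathcal L:V_h\to V_h$. Condition number. For an operator on $V_h$ that is symmetric and positive definite with respect to $a(\cdot,\cdot)$, $\kappa$ denotes the ratio of its largest to its smallest eigenvalue. *)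

(* Defs.v *)
From HB Require Import structures.
From mathcomp Require Import all_boot all_order all_algebra.
From mathcomp Require Import complex.
From mathcomp Require Import all_classical all_reals all_analysis.

Set Implicit Arguments.
Unset Strict Implicit.
Unset Printing Implicit Defensive.

Import Order.TTheory GRing.Theory Num.Theory.
Import numFieldNormedType.Exports.

Local Open Scope classical_set_scope.
Local Open Scope ring_scope.

(* MathComp-Analysis has no Lebesgue measure on R^d; [lebesgue_tuple R d] is
   the d-fold product of [lebesgue_measure] on the product sigma-algebra of
   d-tuples, transported along (x, t) |-> x :: t.  Points of R^d are row
   vectors (which carry the topology and the derivatives); [point_of] is the
   identification of tuples with row vectors. *)

Definition tcons (R : realType) (d : nat)
    (p : measurableTypeR R * d.-tuple (measurableTypeR R)) :
  d.+1.-tuple (measurableTypeR R) := [the d.+1.-tuple _ of p.1 :: p.2].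

Lemma measurable_tcons (R : realType) (d : nat) :
  measurable_fun [set: measurableTypeR R * d.-tuple (measurableTypeR R)]
    (@tcons R d).
Proof. exact: (measurable_cons measurable_fst measurable_snd). Qed.

(* Restated because inference on a product measure only finds the instance for
   subprobabilities. *)
Lemma prod_sigma_finite d1 d2 (T1 : measurableType d1)
    (T2 : measurableType d2) (R : realType)
    (m1 : {sigma_finite_measure set T1 -> \bar R})
    (m2 : {sigma_finite_measure set T2 -> \bar R}) :
  sigma_finite setT (m1 \x m2)%E.
Proof.
have /sigma_finiteP[F [TF ndF Foo]] := sigma_finiteT m1.
have /sigma_finiteP[G [TG ndG Goo]] := sigma_finiteT m2.
exists (fun n => F n `*` G n).
  rewrite -setXTT TF TG predeqE => -[x y]; split.
    move=> [/= [n _ Fnx] [k _ Gky]]; exists (maxn n k) => //; split.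
      by move: x Fnx; exact/subsetPset/ndF/leq_maxl.
    by move: y Gky; exact/subsetPset/ndG/leq_maxr.
  by move=> [n _ []/= ? ?]; split; exists n.
move=> k; have [? ?] := Foo k; have [? ?] := Goo k.
split; first exact: measurableX.
by rewrite product_measure1E// lte_mul_pinfty// ge0_fin_numE.
Qed.

Section lebesgue_step.
Context (R : realType) (d : nat).
Variable m :
  {sigma_finite_measure set (d.-tuple (measurableTypeR R)) -> \bar R}.

Definition leb_step : set (d.+1.-tuple (measurableTypeR R)) -> \bar R :=
  pushforward (@lebesgue_measure R \x m)%E (@tcons R d).

HB.instance Definition _ := Measure.copy leb_step
  (measure_function_pushforward__canonical__measure_function_Measure
     (@lebesgue_measure R \x m)%E (@measurable_tcons R d)).

Let leb_step_sigma_finite : sigma_finite setT leb_step.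
Proof.
have [F TF Foo] := @prod_sigma_finite _ _ _ _ _ (@lebesgue_measure R) m.
pose s (t : d.+1.-tuple (measurableTypeR R)) := (thead t, [tuple of behead t]).
have ms : measurable_fun [set: d.+1.-tuple (measurableTypeR R)] s.
  apply: measurable_fun_pair; first exact: measurable_tnth.
  exact: measurable_behead.
exists (fun k => s @^-1` F k); first by rewrite -preimage_bigcup -TF.
move=> k; have [mF Fk] := Foo k; split.
  by rewrite -[X in measurable X]setTI; exact: ms.
rewrite /leb_step /pushforward -comp_preimage (_ : _ \o _ = id)//.
apply/funext => -[x t] /=; rewrite /s /tcons /= theadE.
by congr pair; exact/val_inj.
Qed.

HB.instance Definition _ := Measure_isSigmaFinite.Build _ _ _
  leb_step leb_step_sigma_finite.

End lebesgue_step.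

Fixpoint lebesgue_tuple (R : realType) (d : nat) :
    {sigma_finite_measure set (d.-tuple (measurableTypeR R)) -> \bar R} :=
  match d with
  | 0 => \d_([tuple] : 0.-tuple (measurableTypeR R))
  | d'.+1 => leb_step (lebesgue_tuple R d')
  end.

Section euclidean.
Context (R : realType) (d : nat).
Implicit Types (D : set 'rV[R]_d) (u v : 'rV[R]_d -> R).

Definition point_of (t : d.-tuple (measurableTypeR R)) : 'rV[R]_d :=
  \row_i (tnth t i : R).

Definition integral_on D (f : 'rV[R]_d -> R) : R :=
  \int[lebesgue_tuple R d]_(t in point_of @^-1` D) f (point_of t).

Definition ae_on D (P : 'rV[R]_d -> Prop) : Prop :=
  {ae lebesgue_tuple R d, forall t, D (point_of t) -> P (point_of t)}.

Definition zvec (j : 'rV[int]_d) : 'rV[R]_d := map_mx intr j.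

Definition cube (s : R) : set 'rV[R]_d :=
  [set x | forall i, 0 <= x 0 i <= s].

(* The k-th closed cell of the uniform mesh with n cells of size 1/n per
   direction. *)
Definition cell (n : nat) (k : {ffun 'I_d -> 'I_n}) : set 'rV[R]_d :=
  [set x | forall i, (k i)%:R / n%:R <= x 0 i <= (k i).+1%:R / n%:R].

Definition multilinear (p : 'rV[R]_d -> R) : Prop :=
  exists c : {set 'I_d} -> R,
    forall x, p x = \sum_(S : {set 'I_d}) c S * \prod_(i in S) x 0 i.

(* The Q1 space with zero boundary values on the uniform mesh of the unit
   cube; its functions are extended by zero to R^d, so that global continuity
   forces them to vanish on the boundary. *)
Definition Q1_space (n : nat) : set ('rV[R]_d -> R) :=
  [set v | [/\ continuous v,
               forall x, ~ cube 1 x -> v x = 0 &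
               forall k : {ffun 'I_d -> 'I_n},
                 exists2 p, multilinear p & forall x, cell k x -> v x = p x]].

(* Classical partial derivatives: a Q1 function is differentiable off the faces
   of its mesh, and there the classical gradient is the weak one. *)
Definition energy D (A : 'rV[R]_d -> R) u v : R :=
  integral_on D (fun x => A x *
    \sum_(i < d) 'D_(delta_mx 0 i) u x * 'D_(delta_mx 0 i) v x).

(* The u in W with b(u, w) = g(w) for all w in W.  An element g of the dual of
   V_h is given as a functional on all functions, of which only the values on
   W (a subset of V_h) are used. *)
Definition galerkin (W : set ('rV[R]_d -> R))
    (b : ('rV[R]_d -> R) -> ('rV[R]_d -> R) -> R)
    (g : ('rV[R]_d -> R) -> R) : 'rV[R]_d -> R :=
  xget 0 [set u | W u /\ forall w, W w -> b u w = g w].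

(* Eigenvalues of the complexification of T on V:
   T (u + i v) = z (u + i v) with u + i v <> 0. *)
Definition spectrum (V : set ('rV[R]_d -> R))
    (T : ('rV[R]_d -> R) -> ('rV[R]_d -> R)) : set R[i] :=
  [set z | exists u v, [/\ V u, V v, u <> 0 \/ v <> 0,
     T u = complex.Re z *: u - complex.Im z *: v &
     T v = complex.Im z *: u + complex.Re z *: v]].

(* For an operator symmetric with respect to an inner product on the
   finite-dimensional space V <> 0, the spectrum is real, finite and nonempty,
   so that sup and inf are the largest and the smallest eigenvalue. *)
Definition condition_number (V : set ('rV[R]_d -> R))
    (T : ('rV[R]_d -> R) -> ('rV[R]_d -> R)) : R :=
  let E := [set t : R | spectrum V T (t%:C)%C] in sup E / inf E.

End euclidean.

(* Mesh sizes are H = 1 / nH and h = 1 / nh; [defect] is the realization of the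
   Bernoulli variables (only its values on [defect_sites] matter); [jref]
   enumerates the defect positions of the reference patch, so that
   [jref l] is j_(l+1). *)
Record model (R : realType) (d : nat) := Model {
  nH : nat;
  nh : nat;
  eps : R;
  Aper : 'rV[R]_d -> R;
  Bper : 'rV[R]_d -> R;
  alpha : R;
  beta : R;
  Qcell : set 'rV[R]_d;
  defect : 'rV[int]_d -> bool;
  Nref : nat;
  jref : 'I_Nref -> 'rV[int]_d
}.

Section model_theory.
Context (R : realType) (d : nat) (M : model R d).
Implicit Types (x : 'rV[R]_d) (v w : 'rV[R]_d -> R)
  (g : ('rV[R]_d -> R) -> R).

Local Notation Omega := (@cube R d 1).

Definition Aeps x : R := Aper M ((eps M)^-1 *: x).
Definition Beps x : R := Bper M ((eps M)^-1 *: x).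

Definition defect_cell (j : 'rV[int]_d) : set 'rV[R]_d :=
  [set eps M *: (zvec R j + q) | q in Qcell M].

Definition defect_sites : set 'rV[int]_d :=
  [set j | defect_cell j `<=` Omega].

Definition coef x : R :=
  Aeps x + \sum_(j \in defect_sites)
    (defect M j)%:R * \1_(defect_cell j) x * Beps x.

Definition Vh : set ('rV[R]_d -> R) := Q1_space (nh M).
Definition VH : set ('rV[R]_d -> R) := Q1_space (nH M).

(* k stands for the interior coarse vertex with coordinates (k i + 1) H. *)
Definition vertex := {ffun 'I_d -> 'I_(nH M).-1}.

Definition nodal (k : vertex) x : R :=
  \prod_(i < d) Num.max 0 (1 - `|(nH M)%:R * x 0 i - (k i).+1%:R|).

Definition patch (k : vertex) : set 'rV[R]_d :=
  closure [set x | nodal k x != 0].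

Definition ref_patch : set 'rV[R]_d := @cube R d (2 / (nH M)%:R).

(* [patch k] is the translate of [ref_patch] by [patch_offset k]. *)
Definition patch_offset (k : vertex) : 'rV[R]_d := \row_i ((k i)%:R / (nH M)%:R).

Definition Vloc (k : vertex) : set ('rV[R]_d -> R) :=
  [set v | Vh v /\ forall x, ~ patch k x -> v x = 0].

Definition Aref (l : 'I_(Nref M).+1) x : R :=
  Aeps x +
  if unlift ord0 l is Some l' then \1_(defect_cell (jref l')) x * Beps x else 0.

Definition Aloc (k : vertex) (l : 'I_(Nref M).+1) x : R :=
  Aref l (x - patch_offset k).

Definition defect_at (k : vertex) (l : 'I_(Nref M)) : Prop :=
  exists j, [/\ defect_sites j, defect M j &
    defect_cell j = [set x + patch_offset k | x in defect_cell (jref l)]].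

Definition mu (k : vertex) (l : 'I_(Nref M).+1) : R :=
  if unlift ord0 l is Some l' then `[< defect_at k l' >]%:R
  else 1 - \sum_(l' < Nref M) `[< defect_at k l' >]%:R.

Definition aform v w : R := energy Omega coef v w.
Definition anorm v : R := Num.sqrt (aform v v).
Definition Lop v : ('rV[R]_d -> R) -> R := aform v.

Definition B0 g : 'rV[R]_d -> R := galerkin VH aform g.
Definition Bi (k : vertex) g : 'rV[R]_d -> R := galerkin (Vloc k) aform g.
Definition Bex g : 'rV[R]_d -> R := B0 g + \sum_(k : vertex) Bi k g.
Definition Pex v : 'rV[R]_d -> R := Bex (Lop v).

Definition Bref (k : vertex) (l : 'I_(Nref M).+1) g : 'rV[R]_d -> R :=
  galerkin (Vloc k) (energy (patch k) (Aloc k l)) g.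
Definition Btilde_loc (k : vertex) g : 'rV[R]_d -> R :=
  \sum_(l < (Nref M).+1) mu k l *: Bref k l g.
Definition Btilde g : 'rV[R]_d -> R :=
  B0 g + \sum_(k : vertex) Btilde_loc k g.
Definition Ptilde v : 'rV[R]_d -> R := Btilde (Lop v).

(* Taken in the extended reals, so that the supremum needs no a priori bound. *)
Definition eta : \bar R :=
  ereal_sup [set (`|aform (Ptilde v - Pex v) v| / anorm v ^+ 2)%:E |
             v in [set v | Vh v /\ v <> 0]].

Record standing : Prop := Standing {
  dim_range : (0 < d <= 3)%N;
  mesh_range : (0 < nH M < nh M)%N;
  mesh_nested : (nH M %| nh M)%N;
  eps_range : (nh M)%:R^-1 <= eps M < (nH M)%:R^-1;
  alpha_beta : 0 < alpha M <= beta M;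
  Aper_measurable : measurable_fun setT (Aper M \o @point_of R d);
  Bper_measurable : measurable_fun setT (Bper M \o @point_of R d);
  Aper_periodic : forall j x, Aper M (x + zvec R j) = Aper M x;
  Bper_periodic : forall j x, Bper M (x + zvec R j) = Bper M x;
  Aper_bounds : ae_on setT (fun x => alpha M <= Aper M x <= beta M);
  ABper_bounds :
    ae_on setT (fun x => alpha M <= Aper M x + Bper M x <= beta M);
  Qcell_unit : Qcell M `<=` cube 1;
  Qcell_measurable : measurable (@point_of R d @^-1` Qcell M);
  coef_bounds : ae_on Omega (fun x => alpha M <= coef x <= beta M);
  coarse_aligned : forall k k' : {ffun 'I_d -> 'I_(nH M)},
    ae_on (cell k) (fun x =>
      Aeps (x + \row_i (((k' i)%:R - (k i)%:R) / (nH M)%:R)) = Aeps x);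
  jref_enum : set_bij setT [set j | defect_cell j `<=` ref_patch] (@jref R d M);
  coef_patch : forall k : vertex,
    ae_on (patch k) (fun x =>
      coef x = \sum_(l < (Nref M).+1) mu k l * Aloc k l x)
}.

End model_theory.

(* Main.v *)
Require Import Defs.
From mathcomp Require Import all_boot all_order all_algebra finmap.
From mathcomp Require Import complex ring lra zify.
From mathcomp Require Import all_classical all_reals all_analysis.
From mathcomp Require Import measurable_realfun.

(** The estimate itself is a triangle inequality: [a(Ptilde v, v)] differs from
    [a(P v, v)] by at most [eta * a(v, v)].  If [Ptilde] is symmetric for the
    inner product [a], then for [Ptilde f = z f] with [f = u + i v] the real part
    of [z] is a Rayleigh quotient and its imaginary part is zero
    ([symmetric_spectrum]).  The bound on the condition number follows from the
    location of the spectrum alone ([condition_number_le]).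

    Symmetry holds for every local solver, whatever coefficient it uses: if
    [T u] in [W] solves [b(T u, w) = a(u, w)] for all [w] in [W], then
    [a(T u, v) = b(T v, T u)] is symmetric in [u] and [v]
    ([galerkin_symmetric]).  This requires that the local problems be solvable,
    hence that the energy forms be inner products on the finite element spaces,
    with the coefficient [A] on the cube and with each reference coefficient on
    each patch.  Finite dimension then gives the solutions
    ([riesz_representation]).

    Bilinearity of the energy ([energy_linear]) needs integrable densities.
    Outside the null skeleton of the mesh, a Q1 function has partial derivatives
    which agree with a bounded measurable function ([Q1_gradient]); values on a
    null set do not change an integral, even for an integrand that is not
    measurable ([integral_setD_null]).

    Definiteness ([energy_gt0]) holds because an elliptic coefficient forces the
    gradient of a function of zero energy to vanish almost everywhere; a Q1
    function whose derivative in one fixed direction vanishes almost everywhere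
    is constant in that direction on each cell, and hence zero because it
    vanishes on the boundary of the cube ([Q1_eq0]).

    The reference coefficients are elliptic because the essential bounds on
    [Aper] and [Aper + Bper] survive translation and scaling: affine changes of
    variable preserve the null sets of the product Lebesgue measure
    ([lebesgue_tuple_affine_null]). *)

Set Implicit Arguments.
Unset Strict Implicit.

Import Order.TTheory GRing.Theory Num.Theory.
Import numFieldNormedType.Exports.

Local Open Scope classical_set_scope.
Local Open Scope ring_scope.

(** * Riesz representation in finite dimension *)

Definition subspace_of {K : realFieldType} {V : lmodType K} (W : set V) : Prop :=
  W 0 /\ forall a u v, W u -> W v -> W (a *: u + v).

Definition linear_on {K : realFieldType} {V : lmodType K} (W : set V)
    (g : V -> K) : Prop :=
  forall a u v, W u -> W v -> g (a *: u + v) = a * g u + g v.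

Definition inner_product_on {K : realFieldType} {V : lmodType K} (W : set V)
    (b : V -> V -> K) : Prop :=
  [/\ forall u v, W u -> W v -> b u v = b v u,
      forall w, W w -> linear_on W (b ^~ w) &
      forall w, W w -> w <> 0 -> 0 < b w w].

Fixpoint spanned_by {K : realFieldType} {V : lmodType K} (s : seq V) (v : V) :
    Prop :=
  if s is e :: s' then exists c, spanned_by s' (v - c *: e) else v = 0.

Section abstract_riesz.
Context {K : realFieldType} {V : lmodType K}.
Implicit Types (W : set V) (s : seq V) (b : V -> V -> K) (g : V -> K).

Lemma spanned_by0 s : spanned_by s 0.
Proof. by elim: s => //= e s IH; exists 0; rewrite scale0r subr0. Qed.

Lemma spanned_by_lin s a u v :
  spanned_by s u -> spanned_by s v -> spanned_by s (a *: u + v).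
Proof.
elim: s u v => [|e s IH] u v /=; first by move=> -> ->; rewrite scaler0 addr0.
move=> [c hc] [c' hc']; exists (a * c + c').
have := IH _ _ hc hc'; congr spanned_by.
by rewrite scalerDl scalerBr scalerA opprD addrACA.
Qed.

Lemma spanned_by_mem s e : e \in s -> spanned_by s e.
Proof.
elim: s => // f s IH; rewrite inE => /orP[/eqP->|/IH h] /=.
  by exists 1; rewrite scale1r subrr; exact: spanned_by0.
by exists 0; rewrite scale0r subr0.
Qed.

Lemma spanned_by_sum s (I : Type) (r : seq I) (c : I -> K) (f : I -> V) :
  (forall i, f i \in s) -> spanned_by s (\sum_(i <- r) c i *: f i).
Proof.
move=> fs; elim: r => [|i r IH]; first by rewrite big_nil; exact: spanned_by0.
rewrite big_cons; apply: spanned_by_lin => //; exact: spanned_by_mem.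
Qed.

Lemma subspaceZ W a u : subspace_of W -> W u -> W (a *: u).
Proof. by move=> [W0 WL] Wu; rewrite -[_ *: _]addr0; exact: WL. Qed.

Lemma subspaceD W u v : subspace_of W -> W u -> W v -> W (u + v).
Proof. by move=> [W0 WL] Wu Wv; rewrite -[u]scale1r; exact: WL. Qed.

Lemma subspaceB W u v : subspace_of W -> W u -> W v -> W (u - v).
Proof.
by move=> sW Wu Wv; rewrite addrC -scaleN1r; case: sW => _; apply.
Qed.

Lemma subspace_sum W (I : Type) (r : seq I) (f : I -> V) :
  subspace_of W -> (forall i, W (f i)) -> W (\sum_(i <- r) f i).
Proof.
move=> sW Wf; elim: r => [|i r IH]; first by rewrite big_nil; case: sW.
by rewrite big_cons; exact: subspaceD.
Qed.

Lemma linear_on0 W g : subspace_of W -> linear_on W g -> g 0 = 0.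
Proof.
by move=> [W0 _] /(_ (-1) 0 0 W0 W0); rewrite scaler0 addr0 mulN1r addNr.
Qed.

Lemma linear_onZ W g a u : subspace_of W -> linear_on W g -> W u ->
  g (a *: u) = a * g u.
Proof.
move=> sW.
have W0 : W 0 by case: sW.
by move=> lg Wu; rewrite -[a *: u]addr0 lg// (linear_on0 sW lg) addr0.
Qed.

Lemma linear_onD W g u v : linear_on W g -> W u -> W v ->
  g (u + v) = g u + g v.
Proof. by move=> lg Wu Wv; rewrite -{1}[u]scale1r lg// mul1r. Qed.

Lemma linear_onB W g u v : linear_on W g -> W u -> W v ->
  g (u - v) = g u - g v.
Proof. by move=> lg Wu Wv; rewrite addrC -scaleN1r lg// mulN1r addrC. Qed.

Lemma linear_on_sum W g (I : Type) (r : seq I) (f : I -> V) :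
  subspace_of W -> linear_on W g -> (forall i, W (f i)) ->
  g (\sum_(i <- r) f i) = \sum_(i <- r) g (f i).
Proof.
move=> sW lg Wf; elim: r => [|i r IH]; first by rewrite !big_nil (linear_on0 sW lg).
by rewrite !big_cons (linear_onD lg) ?IH//; exact: subspace_sum.
Qed.

(** Induction on the spanning family: the vectors of [W] spanned by all but the
    first generator form a subspace [W'] of codimension at most one, and a
    solution on [W'] is corrected along a vector orthogonal to [W'], itself
    obtained by applying the induction hypothesis to an inner product. *)
Lemma riesz_representation W s b g :
  subspace_of W -> (forall v, W v -> spanned_by s v) ->
  inner_product_on W b -> linear_on W g ->
  exists u, W u /\ forall w, W w -> b u w = g w.
Proof.
elim: s W g => [|e s IH] W g sW Ws ib lg.
  exists 0; split; first by case: sW.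
  move=> w Ww; have -> := Ws _ Ww; rewrite (linear_on0 sW lg).
  have [_ lb _] := ib; have W0 : W 0 by case: sW.
  exact: (linear_on0 sW (lb _ W0)).
pose W' := [set w | W w /\ spanned_by s w].
have W'W : W' `<=` W by move=> w [].
have sW' : subspace_of W'.
  split; first by split; [case: sW|exact: spanned_by0].
  move=> a u v [Wu su] [Wv sv]; split; first by case: sW => _ h; apply: h.
  exact: spanned_by_lin.
have [sb lb pb] := ib.
have lW' h : linear_on W h -> linear_on W' h.
  by move=> lh a u v /W'W ? /W'W ?; exact: lh.
have ib' : inner_product_on W' b.
  split; [by move=> u v /W'W ? /W'W ?; exact: sb| |].
    by move=> w /W'W Ww; exact/lW'/lb.
  by move=> w /W'W; exact: pb.
have solve h : linear_on W h -> exists u, W' u /\ forall w, W' w -> b u w = h w.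
  by move=> lh; apply: IH => //; [move=> v []|exact: lW'].
have [u [W'u hu]] := solve _ lg.
have [WW'|] := pselect (forall w, W w -> W' w).
  by exists u; split; [exact: W'W|move=> w /WW'; exact: hu].
move=> /existsNP[w0 /not_implyP[Ww0 W'w0]].
have [p [W'p hp]] := solve _ (lb _ Ww0).
(* [p] is the orthogonal projection of [w0] on [W']. *)
pose z := w0 - p.
have Wz : W z by apply: subspaceB => //; exact: W'W.
have z0 : z <> 0 by move=> /eqP; rewrite subr_eq0 => /eqP w0p; apply: W'w0; rewrite w0p.
have bzW' w : W' w -> b z w = 0.
  move=> W'w; rewrite (linear_onB (lb _ (W'W _ W'w)))//; last exact: W'W.
  by rewrite hp// (sb w0)// ?subrr//; exact: W'W.
have bzz := pb _ Wz z0.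
have [c0 hc0] := Ws _ Ww0.
have c0_neq0 : c0 != 0.
  by apply/eqP => c00; apply: W'w0; split => //; move: hc0; rewrite c00 scale0r subr0.
have decomp w : W w -> exists t, W' (w - t *: z).
  move=> Ww; have [c hc] := Ws _ Ww; exists (c / c0); split.
    by apply: subspaceB => //; exact: subspaceZ.
  have -> : w - (c / c0) *: z =
      (- (c / c0)) *: (w0 - c0 *: e) + ((c / c0) *: p + (w - c *: e)).
    have abel (x f y q : V) : x - (y - q) = f - y + (q + (x - f)).
      by rewrite opprB [f - y]addrC -addrA [f + _]addrCA [f + _]addrCA subrr addr0
                 [q + x]addrC addrCA [q - y]addrC.
    rewrite /z scaleNr !scalerBr scalerA divfK// opprB.
    by rewrite opprB -[X in _ + X = _]opprB; exact: abel.
  apply: spanned_by_lin => //; apply: spanned_by_lin => //.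
  by case: W'p.
exists (u + (g z - b u z) / b z z *: z); have Wu := W'W _ W'u.
split; first by apply: subspaceD => //; exact: subspaceZ.
move=> w Ww; have [t W't] := decomp _ Ww.
have -> : w = t *: z + (w - t *: z) by rewrite addrC subrK.
have Wt := W'W _ W't.
have Wtz : W (t *: z) by exact: subspaceZ.
have Wcz : W ((g z - b u z) / b z z *: z) by exact: subspaceZ.
rewrite lg// (linear_onD (lb _ _))//; last first.
  by rewrite addrC subrK.
rewrite (linear_onZ _ sW (lb _ _))//; last by rewrite addrC subrK.
have lin v : W v -> b v (t *: z + (w - t *: z)) = t * b v z + b v (w - t *: z).
  move=> Wv; rewrite (sb v); [|done|by rewrite addrC subrK].
  by rewrite (lb _ Wv)// (sb z) ?(sb (w - _)).
rewrite !lin// (bzW' _ W't) (hu _ W't).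
by field; rewrite gt_eqF.
Qed.

End abstract_riesz.

(** * Lebesgue measure on tuples *)

Definition closed_box {R : realType} {d : nat} (a b : 'rV[R]_d) : set 'rV[R]_d :=
  [set x | forall i, a 0 i <= x 0 i <= b 0 i].

Definition open_box {R : realType} {d : nat} (a b : 'rV[R]_d) : set 'rV[R]_d :=
  [set x | forall i, a 0 i < x 0 i < b 0 i].

Section lebesgue_measure_on_tuples.
Context {R : realType}.
Local Notation leb := (@lebesgue_measure R).
Local Notation mu := (lebesgue_tuple R).

Lemma measurable_box d (F : 'I_d -> set (measurableTypeR R)) :
  (forall i, measurable (F i)) ->
  measurable [set t : d.-tuple (measurableTypeR R) | forall i, F i (tnth t i)].
Proof.
move=> mF; rewrite (_ : [set t | _] =
    \bigcap_(i in [set: 'I_d]) ((fun t => tnth t i) @^-1` (F i))).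
  apply: fin_bigcap_measurable => // i _.
  by rewrite -[X in measurable X]setTI; exact: measurable_tnth.
by apply/seteqP; split => [t h i _|t h i]; exact: h.
Qed.

(** With arbitrary measurable factors, this covers hyperplanes as well as bounded
    boxes. *)
Lemma lebesgue_tuple_box d (F : 'I_d -> set (measurableTypeR R)) :
  (forall i, measurable (F i)) ->
  mu d [set t | forall i, F i (tnth t i)] = (\prod_(i < d) leb (F i))%E.
Proof.
elim: d F => [|d IH] F mF.
  by rewrite big_ord0 /= diracE mem_set// => -[].
rewrite big_ord_recl -IH// -product_measure1E//; last first.
  by apply: (@measurable_box d (fun i => F (lift ord0 i))) => i; exact: mF.
congr (product_measure1 _ _ _).
apply/seteqP; split => [[x t] h|[x t] [/= h0 h] i]; last first.
  by have [j ->|->] := unliftP ord0 i; rewrite ?tnthS.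
split => [|i /=]; first exact: (h ord0).
by have := h (lift ord0 i); rewrite tnthS.
Qed.

(** The measure [A |-> s * leb (phi^-1 A)] agrees with the Lebesgue measure on
    intervals. *)
Lemma lebesgue_affine_null (s c : R) (A : set (measurableTypeR R)) : 0 < s ->
  measurable A -> leb A = 0 -> leb ((fun x => s * x + c) @^-1` A) = 0.
Proof.
move=> s0 mA A0.
pose phi : measurableTypeR R -> measurableTypeR R := fun x => s * x + c.
have mphi : measurable_fun [set: measurableTypeR R] phi.
  by apply: measurable_funD => //; exact: measurable_funM.
have h : forall X : set (measurableTypeR R), ocitv X ->
   leb X = mscale (NngNum (ltW s0)) (pushforward leb phi) X.
  move=> ? _ [[a b]] _ <-; rewrite /mscale/= /pushforward.
  have -> : phi @^-1` `]a, b] = `](a - c) / s, (b - c) / s]%classic.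
    apply/seteqP; split => x; rewrite /= !in_itv/= /phi.
      by rewrite ltr_pdivrMr// ler_pdivlMr// ltrBlDr lerBrDr mulrC.
    by rewrite ltr_pdivrMr// ler_pdivlMr// ltrBlDr lerBrDr mulrC.
  rewrite !lebesgue_measure_itv/= !lte_fin ltr_pM2r ?invr_gt0// ltrD2r.
  case: ifPn => _; rewrite ?mule0// -!EFinB -EFinM; congr EFin.
  by field; rewrite gt_eqF.
have := lebesgue_measure_unique (h mphi) mA.
rewrite A0 /mscale/= => /esym/eqP; rewrite mule_eq0 => /orP[|/eqP//].
by rewrite eqe gt_eqF.
Qed.

(** Reduces statements on null sets to almost all sections, for inductions on
    the dimension. *)
Lemma lebesgue_tuple_null d (A : set (d.+1.-tuple (measurableTypeR R))) :
  measurable A ->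
  mu d.+1 A = 0 <->
  {ae leb, forall x, mu d (xsection (@tcons R d @^-1` A) x) = 0%E}.
Proof.
move=> mA.
have mB : measurable (@tcons R d @^-1` A).
  by rewrite -[X in measurable X]setTI; exact: measurable_tcons.
have := @ae_eq_integral_abs _ _ _ leb setT measurableT
  (mu d \o xsection (@tcons R d @^-1` A)) (measurable_fun_xsection _ mB).
move=> h; split => [A0|A0].
  have /h : (\int[leb]_x `| (mu d \o xsection (@tcons R d @^-1` A)) x | = 0)%E.
    by under eq_integral do rewrite gee0_abs//.
  by apply: filterS => x /= ->.
have : ae_eq leb setT (mu d \o xsection (@tcons R d @^-1` A)) (cst 0%E).
  by move: A0; apply: filterS => x /= ->.
move=> /h; under eq_integral do rewrite gee0_abs//.
by [].
Qed.

Definition affine_tuple d (s : R) (c : 'rV[R]_d)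
    (t : d.-tuple (measurableTypeR R)) : d.-tuple (measurableTypeR R) :=
  [tuple s * tnth t i + c 0 i | i < d].

Lemma point_of_affine d s (c : 'rV[R]_d) t :
  point_of (affine_tuple s c t) = s *: point_of t + c.
Proof. by apply/rowP => i; rewrite !mxE tnth_mktuple. Qed.

Lemma measurable_affine_tuple d s (c : 'rV[R]_d) :
  measurable_fun setT (affine_tuple s c).
Proof.
apply/measurable_fun_tnthP => i.
rewrite (_ : _ \o _ = fun t => s * tnth t i + c 0 i); last first.
  by apply/funext => t /=; rewrite tnth_mktuple.
apply: measurable_funD => //; apply: measurable_funM => //.
exact: measurable_tnth.
Qed.

(** Induction on the dimension: the sections of the preimage are preimages of
    sections under an affine map of lower dimension. *)
Lemma lebesgue_tuple_affine_null d s (c : 'rV[R]_d) A : 0 < s ->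
  measurable A -> mu d A = 0 -> mu d (affine_tuple s c @^-1` A) = 0.
Proof.
move=> s0; elim: d c A => [|d IH] c A mA.
  have -> // : affine_tuple s c @^-1` A = A.
  by congr (_ @^-1` A); apply/funext => t; rewrite [RHS]tuple0 [LHS]tuple0.
have mA' : measurable (affine_tuple s c @^-1` A).
  by rewrite -[X in measurable X]setTI; exact: measurable_affine_tuple.
move=> /(lebesgue_tuple_null mA)[N [mN N0 sN]].
apply/(lebesgue_tuple_null mA').
exists ((fun x => s * x + c 0 ord0) @^-1` N); split.
- rewrite -[X in measurable X]setTI.
  apply: (_ : measurable_fun _ _) => //.
  by apply: measurable_funD => //; exact: measurable_funM.
- exact: lebesgue_affine_null.
move=> x /= hx; apply: sN => /= h; apply: hx.
have mB : measurable (@tcons R d @^-1` A).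
  by rewrite -[X in measurable X]setTI; exact: measurable_tcons.
have /(IH (\row_i c 0 (lift ord0 i))) {h} := h.
move=> /(_ (measurable_xsection _ mB)) <-; congr (mu d _).
have consE t : affine_tuple s c (tcons (x, t)) =
    tcons (s * x + c 0 ord0, affine_tuple s (\row_i c 0 (lift ord0 i)) t).
  apply/eq_from_tnth => i; rewrite tnth_mktuple /tcons.
  by have [j ->|->] := unliftP ord0 i; rewrite ?tnthS ?tnth_mktuple ?mxE.
by apply/seteqP; split => t; rewrite /xsection /= !inE /= consE.
Qed.

Lemma ae_affine d s (c : 'rV[R]_d) (P : 'rV[R]_d -> Prop) : 0 < s ->
  {ae mu d, forall t, P (point_of t)} ->
  {ae mu d, forall t, P (s *: point_of t + c)}.
Proof.
move=> s0 [N [mN N0 sN]]; exists (affine_tuple s c @^-1` N); split.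
- by rewrite -[X in measurable X]setTI; exact: measurable_affine_tuple.
- exact: lebesgue_tuple_affine_null.
- by move=> t h; apply: sN => /= h'; apply: h => /=; rewrite -point_of_affine.
Qed.

Lemma lebesgue_hyperplane_null d (i : 'I_d) (a : R) :
  mu d [set t | tnth t i = a] = 0.
Proof.
pose F (j : 'I_d) : set (measurableTypeR R) := if j == i then [set a] else setT.
have mF j : measurable (F j) by rewrite /F; case: ifP.
have -> : [set t : d.-tuple (measurableTypeR R) | tnth t i = a] =
    [set t | forall j, F j (tnth t j)].
  apply/seteqP; split => [t /= ta j|t /= /(_ i)]; last by rewrite /F eqxx.
  by rewrite /F; case: eqP => // ->.
rewrite (lebesgue_tuple_box mF) (bigD1 i)//= /F eqxx.
by rewrite lebesgue_measure_set1 mul0e.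
Qed.

Lemma measurable_hyperplane d (i : 'I_d) (a : R) :
  measurable [set t : d.-tuple (measurableTypeR R) | tnth t i = a].
Proof.
by rewrite -[X in measurable X]setTI; exact: (measurable_tnth i measurableT (measurable_set1 a)).
Qed.

Let preimage_closed_box d (a b : 'rV[R]_d) : @point_of R d @^-1` closed_box a b =
  [set t | forall i, `[a 0 i, b 0 i]%classic (tnth t i)].
Proof.
by apply/seteqP; split => t /= h i; have := h i; rewrite /= in_itv/= mxE.
Qed.

Let preimage_open_box d (a b : 'rV[R]_d) : @point_of R d @^-1` open_box a b =
  [set t | forall i, `]a 0 i, b 0 i[%classic (tnth t i)].
Proof.
by apply/seteqP; split => t /= h i; have := h i; rewrite /= in_itv/= mxE.
Qed.

Lemma measurable_closed_box d (a b : 'rV[R]_d) :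
  measurable (@point_of R d @^-1` closed_box a b).
Proof.
rewrite preimage_closed_box.
by apply: (@measurable_box d (fun i => `[a 0 i, b 0 i]%classic)) => i.
Qed.

Lemma measurable_open_box d (a b : 'rV[R]_d) :
  measurable (@point_of R d @^-1` open_box a b).
Proof.
rewrite preimage_open_box.
by apply: (@measurable_box d (fun i => `]a 0 i, b 0 i[%classic)) => i.
Qed.

Lemma lebesgue_closed_box_lty d (a b : 'rV[R]_d) :
  (mu d (@point_of R d @^-1` closed_box a b) < +oo)%E.
Proof.
rewrite preimage_closed_box.
rewrite (@lebesgue_tuple_box d (fun i => `[a 0 i, b 0 i]%classic))//.
rewrite ltey_eq; apply/orP; left.
elim/big_ind : _ => [//|x y|i _]; first exact: fin_numM.
by rewrite lebesgue_measure_itv/=; case: ifPn => // _; rewrite -EFinB.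
Qed.

Lemma lebesgue_open_box_gt0 d (a b : 'rV[R]_d) : (forall i, a 0 i < b 0 i) ->
  (0 < mu d (@point_of R d @^-1` open_box a b))%E.
Proof.
move=> ab; rewrite preimage_open_box.
rewrite (@lebesgue_tuple_box d (fun i => `]a 0 i, b 0 i[%classic))//.
elim/big_ind : _ => [|x y|i _]; [exact: lte01|exact: mule_gt0|].
by rewrite lebesgue_measure_itv/= lte_fin ab -EFinB lte_fin subr_gt0.
Qed.

End lebesgue_measure_on_tuples.

(** * Topology of boxes and derivatives along lines *)

Section boxes.
Context {R : realType} {d : nat}.
Implicit Types (x y v a b : 'rV[R]_d) (A : set 'rV[R]_d).

Lemma nbhs_rowP x A :
  nbhs x A <-> exists2 e : R, 0 < e &
    forall y, (forall i, `|x 0 i - y 0 i| < e) -> A y.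
Proof.
split => [/nbhs_ballP[e e0 h]|[e e0 h]].
  exists e => // y xy; apply: h; split => // i j.
  by rewrite (ord1 i); exact: xy.
apply/nbhs_ballP; exists e => // y [_ xy]; apply: h => i; exact: xy.
Qed.

Lemma nbhs_line x v A : nbhs x A ->
  exists2 e : R, 0 < e & forall s, `|s| < e -> A (x + s *: v).
Proof.
move=> /nbhs_rowP[e e0 h].
(* A bound of the entries of [v], positive even if [v = 0]. *)
pose m := 1 + \sum_i `|v 0 i|.
have m0 : 0 < m by rewrite ltr_pwDl// sumr_ge0.
exists (e / m); first exact: divr_gt0.
move=> s se; apply: h => i; rewrite !mxE opprD addrA subrr sub0r normrN normrM.
have vm : `|v 0 i| <= m.
  by rewrite /m (bigD1 i)//= addrCA lerDl addr_ge0// sumr_ge0.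
apply: le_lt_trans (_ : `|s| * m < e); first exact: ler_wpM2l.
by rewrite -ltr_pdivlMr.
Qed.

Lemma open_box_nbhs a b x : open_box a b x -> nbhs x (open_box a b).
Proof.
move=> abx; have := @filter_forall _ _ (fun i y => is_true (a 0 i < y 0 i < b 0 i)) (nbhs x) _.
apply => i.
have H : nbhs (x 0 i) `]a 0 i, b 0 i[%classic.
  by apply: open_nbhs_nbhs; split; [exact: interval_open|rewrite /= in_itv/=; exact: abx].
have H' : nbhs x [set y : 'rV[R]_d | `]a 0 i, b 0 i[%classic (y 0 i)].
  exact: (@coord_continuous R 1 d 0 i x) _ H.
by apply: (filterS _ H') => y /=; rewrite in_itv.
Qed.

Lemma closed_closed_box a b : closed (closed_box a b).
Proof.
have -> : closed_box a b =
    \bigcap_(i in [set: 'I_d]) ((fun x => x 0 i) @^-1` `[a 0 i, b 0 i]%classic).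
  apply/seteqP; split => [x h i _|x h i]; first by rewrite /= in_itv; exact: h.
  by have := h i I; rewrite /= in_itv.
apply: closed_bigI => i _; apply: preimage_closed => //.
  by move=> x _; exact: coord_continuous.
exact: interval_closed.
Qed.

(** Moving a point of a closed box towards an interior point of the box leads
    immediately into the open box. *)
Lemma segment_open_box a b c x s : open_box a b c -> closed_box a b x ->
  0 < s <= 1 -> open_box a b (x + s *: (c - x)).
Proof.
move=> hc hx /andP[s0 s1] i; have /andP[ac cb] := hc i; have /andP[ax xb] := hx i.
by rewrite !mxE; apply/andP; split; nra.
Qed.

Lemma nbhs_closed_box a b c x A : open_box a b c -> closed_box a b x ->
  nbhs x A -> exists2 y, A y & open_box a b y.
Proof.
move=> hc hx /(nbhs_line (c - x))[e e0 h].
pose s := Num.min 1 (e / 2).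
have s0 : 0 < s by rewrite lt_min ltr01/= divr_gt0.
exists (x + s *: (c - x)); first apply: h.
  by rewrite gtr0_norm// gt_min; apply/orP; right; lra.
by apply: segment_open_box => //; rewrite s0 ge_min lexx.
Qed.

Lemma closure_open_box a b c : open_box a b c ->
  closure (open_box a b) = closed_box a b.
Proof.
move=> hc; apply/seteqP; split.
  apply: (@subset_trans _ (closure (closed_box a b))).
    by apply: closure_subset => x h i; have /andP[/ltW-> /ltW->] := h i.
  by rewrite -((closure_id _).1 (@closed_closed_box a b)).
move=> x hx B xB; have [y By aby] := nbhs_closed_box hc hx xB.
by exists y.
Qed.

Lemma is_deriveE (f : 'rV[R]_d -> R) x v (c : R) :
  is_derive x v f c -> 'D_v f x = c.
Proof. by case. Qed.

(** The difference quotients along [v] are eventually constant. *)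
Lemma is_derive_line_near (f g : 'rV[R]_d -> R) x v (c : R) :
  {near x, f =1 g} -> (forall h, g (x + h *: v) = g x + h * c) ->
  is_derive x v f c.
Proof.
move=> fg gl.
have fgx : f x = g x by exact: (nbhs_singleton fg).
have [e e0 he] := nbhs_line v fg.
have key : h^-1 *: ((f \o shift x) (h *: v) - f x) @[h --> 0^'] --> c.
  apply: cvg_near_cst; exists e => //= h.
  rewrite /= sub0r normrN => hh h0.
  rewrite [h *: v + x]addrC he// gl fgx addrAC subrr add0r.
  by rewrite scalerA mulVf// scale1r.
by split; [apply/cvg_ex; exists c|exact/cvg_lim].
Qed.

End boxes.

(** * Multilinear functions and the mesh *)

Section multilinear_functions.
Context {R : realType} {d : nat}.
Implicit Types (p q : 'rV[R]_d -> R) (x : 'rV[R]_d).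

Lemma multilinear_lin (a : R) p q :
  multilinear p -> multilinear q -> multilinear (a *: p + q).
Proof.
move=> [c hc] [c' hc']; exists (fun S => a * c S + c' S) => x.
rewrite -[LHS]/(a * p x + q x) hc hc' mulr_sumr -big_split/=.
by apply: eq_bigr => S _; rewrite mulrDl mulrA.
Qed.

Lemma multilinear0 : multilinear (0 : 'rV[R]_d -> R).
Proof. by exists (fun=> 0) => x; rewrite big1// => S _; rewrite mul0r. Qed.

(** A multilinear function is affine along each coordinate line, so that its
    partial derivative is a unit increment. *)
Lemma multilinear_line p x i h : multilinear p ->
  p (x + h *: delta_mx 0 i) = p x + h * (p (x + delta_mx 0 i) - p x).
Proof.
move=> [c hc]; rewrite !hc -sumrB mulr_sumr -big_split/=.
apply: eq_bigr => S _; rewrite -mulrBr mulrCA -mulrDr; congr (_ * _).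
have [iS|iS] := boolP (i \in S); last first.
  have E t : \prod_(j in S) (x + t *: delta_mx 0 i) 0 j = \prod_(j in S) x 0 j.
    apply: eq_bigr => j jS; rewrite !mxE eqxx/=.
    by case: eqP jS iS => [->->//|_ _ _]; rewrite mulr0 addr0.
  by have := E 1; rewrite scale1r E => ->; rewrite subrr mulr0 addr0.
have E t : \prod_(j in S) (x + t *: delta_mx 0 i) 0 j =
    (x 0 i + t) * \prod_(j in S | j != i) x 0 j.
  rewrite (bigD1 i)//= !mxE !eqxx mulr1; congr (_ * _).
  apply: eq_bigr => j /andP[jS /negbTE ji]; rewrite !mxE ji.
  by rewrite andbF mulr0 addr0.
by have := E 1; have := E 0; rewrite scale1r scale0r !addr0 E => -> ->; ring.
Qed.

Lemma multilinear_continuous p : multilinear p -> continuous p.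
Proof.
move=> [c hc]; have -> : p = fun x => \sum_S c S * \prod_(i in S) x 0 i.
  exact/funext.
have ca : continuous (fun x : R * R => x.1 + x.2) by exact: add_continuous.
move=> x; apply: (@cvg_big _ _ _ _ _ ca _ (nbhs x) _ _ _ (nbhs_filter x)) => S _; apply: cvgM; first exact: cvg_cst.
have cm : continuous (fun x : R * R => x.1 * x.2) by exact: mul_continuous.
by apply: (@cvg_big _ _ _ _ _ cm _ (nbhs x) _ _ _ (nbhs_filter x)) => i _; exact: coord_continuous.
Qed.

Lemma multilinear_measurable p : multilinear p ->
  measurable_fun setT (p \o @point_of R d).
Proof.
move=> [c hc].
have -> : p \o @point_of R d =
    fun t => \sum_(S <- index_enum {set 'I_d})
      c S * \prod_(i <- enum S) (tnth t i : R).
  apply/funext => t /=; rewrite hc; apply: eq_bigr => S _.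
  by rewrite big_enum/=; congr (_ * _); apply: eq_bigr => i _; rewrite mxE.
apply: measurable_sum => S; apply: measurable_funM => //.
by apply: measurable_prod => i _; exact: measurable_tnth.
Qed.

Lemma multilinear_bounded p (b : R) : multilinear p ->
  exists B, forall x, (forall i, `|x 0 i| <= b) -> `|p x| <= B.
Proof.
move=> [c hc]; exists (\sum_(S : {set 'I_d}) `|c S| * b ^+ #|S|) => x xb.
rewrite hc; apply: le_trans (ler_norm_sum _ _ _) _.
apply: ler_sum => S _; rewrite normrM ler_wpM2l// normr_prod.
by rewrite -prodr_const; apply: ler_prod => i _; rewrite normr_ge0 xb.
Qed.

End multilinear_functions.

Section mesh.
Context {R : realType} {d : nat}.
Variable n : nat.
Hypothesis n_gt0 : (0 < n)%N.
Implicit Types (x y : 'rV[R]_d) (k : {ffun 'I_d -> 'I_n}).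

Definition cell_lo k : 'rV[R]_d := \row_i ((k i)%:R / n%:R).
Definition cell_hi k : 'rV[R]_d := \row_i ((k i).+1%:R / n%:R).
Definition open_cell k : set 'rV[R]_d := open_box (cell_lo k) (cell_hi k).
Definition cell_center k : 'rV[R]_d := 2^-1 *: (cell_lo k + cell_hi k).

(** The union of the hyperplanes that carry the faces of the mesh. *)
Definition skeleton : set 'rV[R]_d :=
  [set x | exists i, exists m : 'I_n.+1, x 0 i = m%:R / n%:R].

Let n0 : 0 < n%:R :> R. Proof. by rewrite ltr0n. Qed.

Lemma cellE k : @cell R d n k = closed_box (cell_lo k) (cell_hi k).
Proof. by apply/seteqP; split => x h i; have := h i; rewrite !mxE. Qed.

Lemma cubeE (s : R) : @cube R d s = closed_box 0 (const_mx s).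
Proof. by apply/seteqP; split => x h i; have := h i; rewrite !mxE. Qed.

Lemma cell_center_open k : open_cell k (cell_center k).
Proof.
move=> i; rewrite !mxE.
have : (k i)%:R / n%:R < (k i).+1%:R / n%:R :> R.
  by rewrite ltr_pM2r ?invr_gt0// ltr_nat.
by move=> h; apply/andP; split; lra.
Qed.

Lemma open_cell_cell k : open_cell k `<=` @cell R d n k.
Proof. by rewrite cellE => x h i; have /andP[/ltW-> /ltW->] := h i. Qed.

Lemma cell_cube k : @cell R d n k `<=` @cube R d 1.
Proof.
move=> x h i; have /andP[h1 h2] := h i; apply/andP; split.
  by apply: le_trans h1; rewrite divr_ge0.
apply: le_trans h2 _; rewrite ler_pdivrMr// mul1r ler_nat; exact: ltn_ord.
Qed.

Lemma cube_cell x : @cube R d 1 x -> exists k, @cell R d n k x.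
Proof.
move=> hx.
have lt_m i : (minn (Num.truncn (n%:R * x 0%R i)%R) n.-1 < n)%N.
  by rewrite gtn_min prednK// leqnn orbT.
exists [ffun i => Ordinal (lt_m i)] => i; rewrite ffunE/=.
have /andP[x0 x1] := hx i.
have nx0 : 0 <= n%:R * x 0 i by rewrite mulr_ge0.
have /andP[h1 h2] := truncn_itv nx0.
rewrite ler_pdivrMr// ler_pdivlMr// [x 0 i * _]mulrC; apply/andP; split.
  by apply: le_trans h1; rewrite ler_nat geq_minl.
set m := Num.truncn _ in h1 h2 *; have [h|h] := leqP m n.-1.
  exact: ltW.
by rewrite prednK// -[leRHS]mulr1 ler_wpM2l// ltW.
Qed.

Lemma cell_off_skeleton k x : ~ skeleton x -> @cell R d n k x -> open_cell k x.
Proof.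
move=> hx xk i; have /andP[h1 h2] := xk i; rewrite !mxE !lt_neqAle h1 h2 !andbT.
apply/andP; split; apply/eqP => E; apply: hx; exists i.
  by exists (widen_ord (leqnSn n) (k i)).
by exists (lift ord0 (k i)); rewrite E.
Qed.

Lemma measurable_skeleton : measurable (@point_of R d @^-1` skeleton).
Proof.
have -> : @point_of R d @^-1` skeleton =
    \bigcup_(i in [set: 'I_d]) \bigcup_(m in [set: 'I_n.+1])
      [set t | tnth t i = m%:R / n%:R].
  apply/seteqP; split => t.
    by move=> [i [m /=]]; rewrite mxE => E; exists i => //; exists m.
  by move=> [i _ [m _ /= E]]; exists i, m; rewrite mxE.
apply: fin_bigcup_measurable => // i _; apply: fin_bigcup_measurable => // m _.
exact: measurable_hyperplane.
Qed.

Lemma skeleton_null : lebesgue_tuple R d (@point_of R d @^-1` skeleton) = 0.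
Proof.
apply/(measure_negligible measurable_skeleton).
have h (i : 'I_d) (m : 'I_n.+1) :
    {ae lebesgue_tuple R d, forall t, tnth t i <> m%:R / n%:R}.
  exists [set t | tnth t i = m%:R / n%:R]; split.
  - exact: measurable_hyperplane.
  - exact: lebesgue_hyperplane_null.
  - by move=> t /contrapT.
have : {ae lebesgue_tuple R d,
    forall t, forall i (m : 'I_n.+1), tnth t i <> m%:R / n%:R}.
  by apply: filter_forall => i; apply: filter_forall => m; exact: h.
apply: negligibleS => t /= [i [m]]; rewrite mxE => E.
by move=> /(_ i m); rewrite E.
Qed.

End mesh.

(** * Q1 functions *)

Section Q1_functions.
Context {R : realType} {d : nat}.
Implicit Types (u v w : 'rV[R]_d -> R) (x y : 'rV[R]_d).

Lemma Q1_subspace n : subspace_of (@Q1_space R d n).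
Proof.
split.
  split => [x||k]; [exact: cst_continuous|by []|].
  by exists 0 => //; exact: multilinear0.
move=> a u v [cu bu pu] [cv bv pv]; split => [x|x hx|k].
- suff : continuous (fun y => a * u y + v y) by exact.
  move=> y; apply: (@continuousD _ _ _ (fun y => a * u y) v); last exact: cv.
  by apply: (@continuousM _ _ (fun=> a) u); [exact: cst_continuous|exact: cu].
- by rewrite -[LHS]/(a * u x + v x) bu// bv// mulr0 addr0.
have [p mp up] := pu k; have [q mq vq] := pv k.
exists (a *: p + q); first exact: multilinear_lin.
by move=> x kx; rewrite -[LHS]/(a * u x + v x) up// vq.
Qed.

(** With [n = m * r], the fine cell [k] lies in the coarse cell [k %/ r]. *)
Lemma Q1_refine m n : (0 < n)%N -> (m %| n)%N ->
  @Q1_space R d m `<=` Q1_space n.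
Proof.
move=> n0 mn u [cu bu pu]; split => // k.
have m0 : (0 < m)%N by exact: (dvdn_gt0 n0 mn).
have [r nE] := dvdnP mn.
have r0 : (0 < r)%N by move: n0; rewrite nE muln_gt0 => /andP[].
have lt_k i : (k i %/ r < m)%N by rewrite ltn_divLR// mulnC -nE.
have [p mp up] := pu [ffun i => Ordinal (lt_k i)]; exists p => // x kx.
apply: up => i; rewrite ffunE/=; have /andP[h1 h2] := kx i.
have r0' : 0 < r%:R :> R by rewrite ltr0n.
have scale (a : nat) : a%:R / m%:R = (a * r)%:R / n%:R :> R.
  by rewrite nE !natrM; field; rewrite !gt_eqF ?ltr0n.
rewrite !scale; apply/andP; split.
  by apply: le_trans h1; rewrite ler_pM2r ?invr_gt0 ?ltr0n// ler_nat leq_trunc_div.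
apply: le_trans h2 _; rewrite ler_pM2r ?invr_gt0 ?ltr0n// ler_nat.
exact: ltn_ceil.
Qed.

(** On a cell a Q1 function is a combination of monomials.  Points shared by
    several cells are attributed to one of them, so that finitely many
    functions span the space. *)
Definition Q1_monomial n (kS : {ffun 'I_d -> 'I_n} * {set 'I_d}) x : R :=
  if [pick k | `[< @cell R d n k x >]] == Some kS.1
  then \prod_(i in kS.2) x 0 i else 0.

Lemma Q1_spanned n u : (0 < n)%N -> Q1_space n u ->
  spanned_by (codom (@Q1_monomial n)) u.
Proof.
move=> n0 [cu bu pu].
have /choice[c hc] : forall k : {ffun 'I_d -> 'I_n}, exists c : {set 'I_d} -> R,
    forall x, cell k x -> u x = \sum_(S : {set 'I_d}) c S * \prod_(i in S) x 0 i.
  by move=> k; have [p [c pE] up] := pu k; exists c => x kx; rewrite up.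
have -> : u = \sum_(kS : {ffun 'I_d -> 'I_n} * {set 'I_d})
    c kS.1 kS.2 *: Q1_monomial kS.
  apply/funext => x; rewrite fct_sumE.
  rewrite -(pair_bigA _ (fun k S => c k S * Q1_monomial (k, S) x))/=.
  rewrite /Q1_monomial; case: pickP => [k /asboolP kx|nk].
    rewrite (bigD1 k)//= [X in _ + X]big1 ?addr0; last first.
      move=> k' k'k; rewrite big1// => S _.
      by rewrite eq_sym (inj_eq Some_inj) (negbTE k'k) mulr0.
    by rewrite (hc k)//; apply: eq_bigr => S _; rewrite eqxx.
  rewrite bu; last by move=> /(cube_cell n0)[k /asboolP]; rewrite nk.
  by rewrite big1// => k _; rewrite big1// => S _; rewrite mulr0.
by apply: spanned_by_sum => kS; exact: codom_f.
Qed.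

Lemma is_derive_Q1_cell n u k p x i : (0 < n)%N -> multilinear p ->
  (forall y, @cell R d n k y -> u y = p y) -> open_cell k x ->
  is_derive x (delta_mx 0 i) u (p (x + delta_mx 0 i) - p x).
Proof.
move=> n0 mp up kx; apply: (@is_derive_line_near _ _ _ p).
  by apply: filterS (open_box_nbhs kx) => y ky; apply/up/open_cell_cell.
by move=> h; exact: multilinear_line.
Qed.

(** A function that vanishes off a closed set is zero around each point of the
    complement. *)
Lemma is_derive_off_closed (C : set 'rV[R]_d) u x e : closed C ->
  (forall y, ~ C y -> u y = 0) -> ~ C x -> is_derive x e u 0.
Proof.
move=> cC uC Cx; apply: (@is_derive_line_near _ _ _ (cst 0)).
  have : nbhs x (~` C) by apply: open_nbhs_nbhs; split; [exact: closed_openC|].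
  by apply: filterS => y /uC.
by move=> h; rewrite /cst mulr0 addr0.
Qed.

(** On an open cell the gradient is given by the increments of the multilinear
    piece; the witness is their sum, each cut off to its cell. *)
Lemma Q1_gradient n u i : (0 < n)%N -> Q1_space n u ->
  exists G : 'rV[R]_d -> R, [/\ measurable_fun setT (G \o @point_of R d),
    exists B, forall x, `|G x| <= B &
    forall x, ~ skeleton n x -> is_derive x (delta_mx 0 i) u (G x)].
Proof.
move=> n0 [cu bu pu].
have /choice[p hp] : forall k : {ffun 'I_d -> 'I_n}, exists p : 'rV[R]_d -> R,
    multilinear p /\ forall x, cell k x -> u x = p x.
  by move=> k; have [p mp up] := pu k; exists p.
pose q k x := p k (x + delta_mx 0 i) - p k x.
pose G x := \sum_(k : {ffun 'I_d -> 'I_n}) \1_(open_cell k) x * q k x.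
exists G; split.
- rewrite (_ : _ \o _ = fun t => \sum_(k <- index_enum {ffun 'I_d -> 'I_n})
    \1_(@point_of R d @^-1` open_cell k) t * q k (point_of t)) ; last first.
    by apply/funext.
  apply: measurable_sum => k; apply: measurable_funM.
    by apply: measurable_indic; exact: measurable_open_box.
  apply: measurable_funB; last exact: (multilinear_measurable (hp k).1).
  have -> : (fun t => p k (point_of t + delta_mx 0 i)) =
      (p k \o @point_of R d) \o affine_tuple 1 (delta_mx 0 i).
    by apply/funext => t /=; rewrite point_of_affine scale1r.
  apply: measurableT_comp; last exact: measurable_affine_tuple.
  exact: (multilinear_measurable (hp k).1).
(* For [x] in the unit cube the entries of [x] and of [x + delta_mx 0 i] are
   bounded by 2. *)
- have /choice[B hB] : forall k, exists B, forall x, (forall j, `|x 0 j| <= 2) ->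
      `|p k x| <= B by move=> k; apply: multilinear_bounded; exact: (hp k).1.
  exists (\sum_(k : {ffun 'I_d -> 'I_n}) (B k + B k)) => x.
  apply: le_trans (ler_norm_sum _ _ _) _; apply: ler_sum => k _.
  rewrite normrM indicE; case: (boolP (x \in open_cell k)) => [|_]; last first.
    rewrite normr0 mul0r addr_ge0//.
      by apply: le_trans (hB k 0 _) => // j; rewrite mxE normr0.
    by apply: le_trans (hB k 0 _) => // j; rewrite mxE normr0.
  rewrite inE => /open_cell_cell/(cell_cube n0) hx.
  rewrite normr1 mul1r; apply: le_trans (ler_normB _ _) _.
  apply: lerD; apply: hB => j; rewrite ?mxE ?eqxx/=; have /andP[x0 x1] := hx j.
    apply: le_trans (ler_normD _ _) _.
    by rewrite ger0_norm// ger0_norm//; case: eqP => _ /=; lra.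
  by rewrite ger0_norm//; lra.
move=> x sx; have [hx|hx] := pselect (@cube R d 1 x).
  have [k kx] := cube_cell n0 hx.
  have okx := cell_off_skeleton sx kx.
  have -> : G x = q k x.
    rewrite /G (bigD1 k)//= indicE mem_set// mul1r big1 ?addr0// => k' k'k.
    rewrite indicE memNset ?mul0r// => ok'x.
    move/eqP: k'k; apply; apply/ffunP => j; apply: val_inj.
    have := okx j; have := ok'x j; rewrite !mxE.
    rewrite !ltr_pdivlMr ?ltr0n// !ltr_pdivrMr ?ltr0n//.
    move=> /andP[a1 a2] /andP[b1 b2].
    have := lt_trans a1 b2; have := lt_trans b1 a2.
    by rewrite !ltr_nat !ltnS => h1 h2; apply/eqP; rewrite eqn_leq h1 h2.
  exact: (is_derive_Q1_cell i n0 (hp k).1 (hp k).2 okx).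
have -> : G x = 0.
  rewrite /G big1// => k _; rewrite indicE memNset ?mul0r//.
  by move=> /open_cell_cell/(cell_cube n0).
apply: (is_derive_off_closed (C := @cube R d 1)) => //.
by rewrite cubeE; exact: closed_closed_box.
Qed.

Lemma nbhs_neq0 u x : continuous u -> u x != 0 -> nbhs x [set z | u z != 0].
Proof.
move=> cu ux; have : nbhs (u x) [set r : R | r != 0].
  by apply: open_nbhs_nbhs; split => //; exact: open_neq.
exact: cu.
Qed.

(** A multilinear piece has a continuous partial derivative; if it vanishes
    almost everywhere in the open cell then it vanishes on the closed cell,
    since every neighbourhood of a point of the closed cell meets the open cell
    in a set of positive measure. *)
Lemma Q1_cell_increment0 n u i k p : (0 < n)%N -> multilinear p ->
  (forall x, @cell R d n k x -> u x = p x) ->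
  {ae lebesgue_tuple R d, forall t, 'D_(delta_mx 0 i) u (point_of t) = 0} ->
  forall x, @cell R d n k x -> p (x + delta_mx 0 i) - p x = 0.
Proof.
move=> n0 mp up ae0 x kx; apply: contrapT => /eqP qx0.
pose q y := p (y + delta_mx 0 i) - p y.
have cq : continuous q.
  have cp := multilinear_continuous mp.
  move=> y; apply: (@continuousB _ _ _ (fun y => p (y + delta_mx 0 i)) p).
    apply: (@continuous_comp _ _ _ (fun y => y + delta_mx 0 i) p).
      by apply: continuousD; [exact: cvg_id|exact: cst_continuous].
    exact: cp.
  exact: cp.
have nq y : q y != 0 -> nbhs y [set z | q z != 0] by exact: nbhs_neq0.
have [z qz kz] : exists2 z, q z != 0 & open_cell k z.
  apply: (nbhs_closed_box (cell_center_open n0 k) _ (nq _ qx0)).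
  by rewrite -cellE.
have nU : nbhs z ([set y | q y != 0] `&` open_cell k).
  by apply: filterI; [exact: nq|exact: open_box_nbhs].
have [e e0 he] := (nbhs_rowP _ _).1 nU.
pose U := @point_of R d @^-1` open_box (z - const_mx e) (z + const_mx e).
have U0 : lebesgue_tuple R d U = 0.
  apply: measure_negligible; first exact: measurable_open_box.
  apply: negligibleS ae0 => t Ut /= Dt.
  have [qt kt] : ([set y | q y != 0] `&` open_cell k) (point_of t).
    apply: he => j; have := Ut j; rewrite !mxE => /andP[h1 h2].
    by rewrite ltr_norml; apply/andP; split; lra.
  move/eqP: qt; apply.
  by rewrite /q -(is_deriveE (is_derive_Q1_cell i n0 mp up kt)).
have : (0 < lebesgue_tuple R d U)%E.
  by apply: lebesgue_open_box_gt0 => j; rewrite !mxE; lra.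
by rewrite U0 ltxx.
Qed.

(** Along a coordinate direction the function is constant across each layer of
    cells, and it vanishes on the face of the cube where the first layer
    starts. *)
Lemma Q1_eq0 n u (i : 'I_d) : (0 < n)%N -> Q1_space n u ->
  {ae lebesgue_tuple R d, forall t, 'D_(delta_mx 0 i) u (point_of t) = 0} ->
  u = 0.
Proof.
move=> n0 [cu bu pu] ae0.
have n0' : 0 < n%:R :> R by rewrite ltr0n.
have face y : y 0 i = 0 -> u y = 0.
  move=> yi0; apply: contrapT => /eqP uy.
  have [e e0 he] := nbhs_line (- delta_mx 0 i) (nbhs_neq0 cu uy).
  have /he/eqP : `|e / 2| < e by rewrite gtr0_norm; lra.
  apply; apply: bu => /(_ i); rewrite !mxE !eqxx yi0 /= mulrN mulr1 add0r.
  by rewrite oppr_ge0 => /andP[h _]; lra.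
(* Sliding a point along direction [i] to the lower face of its cell, where the
   previous layer ends, does not change the value of [u]. *)
have slide (k : {ffun 'I_d -> 'I_n}) x : cell k x -> exists y,
    (forall j, y 0 j = if j == i then (k i)%:R / n%:R else x 0 j) /\ u x = u y.
  move=> kx; have [p mp up] := pu k.
  pose y := x + ((k i)%:R / n%:R - x 0 i) *: delta_mx 0 i.
  have yE j : y 0 j = if j == i then (k i)%:R / n%:R else x 0 j.
    rewrite !mxE eqxx/=; case: eqP => [->|_]; last by rewrite mulr0 addr0.
    by rewrite mulr1 addrC subrK.
  have ky : cell k y.
    move=> j; rewrite yE; case: eqP => [->|_]; last exact: kx.
    by rewrite lexx/= ler_pM2r ?invr_gt0// ler_nat.
  exists y; split => //; rewrite (up _ kx) (up _ ky) multilinear_line//.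
  by rewrite (Q1_cell_increment0 n0 mp up ae0 kx) mulr0 addr0.
have layer m : forall (k : {ffun 'I_d -> 'I_n}), k i = m :> nat ->
    forall x, cell k x -> u x = 0.
  elim: m => [|m IH] k km x kx; have [y [yE ->]] := slide k x kx.
    by rewrite face// yE eqxx km mul0r.
  have lt_m : (m < n)%N by rewrite ltnW// -km ltn_ord.
  apply: (IH [ffun j => if j == i then Ordinal lt_m else k j]).
    by rewrite ffunE eqxx.
  move=> j; rewrite ffunE yE; case: eqP => [_|_]; last exact: kx.
  by rewrite /= km lexx andbT ler_pM2r ?invr_gt0// ler_nat.
apply/funext => x; have [hx|/bu//] := pselect (@cube R d 1 x).
by have [k kx] := cube_cell n0 hx; exact: (layer (k i) k).
Qed.

End Q1_functions.

(** * Energy forms *)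

Section integral_and_null_sets.
Local Open Scope ereal_scope.
Context {disp : measure_display} {T : measurableType disp} {R : realType}.
Variable mu : {measure set T -> \bar R}.
Import HBNNSimple.

Let sup_nnsfun_null (N : set T) (F : T -> \bar R) : measurable N -> mu N = 0 ->
  (forall x, 0 <= F x) ->
  ereal_sup [set sintegral mu h |
    h in [set h : {nnsfun T >-> R} | forall x, (h x)%:E <= F x]] =
  ereal_sup [set sintegral mu h |
    h in [set h : {nnsfun T >-> R} | forall x, (h x)%:E <= (F \_ (~` N)) x]].
Proof.
move=> mN N0 F0; apply/eqP; rewrite eq_le; apply/andP; split.
  apply: ge_ereal_sup => _ [h /= hF <-].
  have mCN : measurable (~` N) by exact: measurableC.
  apply: ereal_sup_ubound; exists (proj_nnsfun h mCN).
    move=> x; rewrite /= mindicE patchE.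
    by case: ifPn => _; rewrite ?mulr1 ?mulr0.
  rewrite -[RHS]integralT_nnsfun (@ge0_negligible_integral _ _ _ mu setT N)//.
  - rewrite setTD integral_nnsfun//; apply: eq_sintegral => x.
    rewrite /= mindicE patchE.
    by case: ifPn => _; rewrite ?mulr1 ?mulr0.
  - by apply/measurable_EFinP.
  - by move=> x _; rewrite lee_fin; exact: fun_ge0.
apply: le_ereal_sup => _ [h /= hF <-]; exists h => // x.
by apply: le_trans (hF x) _; rewrite patchE; case: ifPn.
Qed.

(** The integral is a difference of suprema over simple functions, for which
    null sets do not count; no measurability of the integrand is involved.
    This is how the values of a gradient on the faces of the mesh, where it
    need not exist, are discarded. *)
Lemma integral_setD_null (D N : set T) (f : T -> \bar R) :
  measurable N -> mu N = 0 ->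
  \int[mu]_(x in D) f x = \int[mu]_(x in D `\` N) f x.
Proof.
move=> mN N0; rewrite /integral setDE setIC patch_setI.
rewrite [in RHS]funepos_restrict [in RHS]funeneg_restrict.
by congr (_ - _); rewrite (sup_nnsfun_null mN).
Qed.

End integral_and_null_sets.

Section energy_form.
Context {R : realType} {d : nat}.
Implicit Types (u v w : 'rV[R]_d -> R) (D C : set 'rV[R]_d).
Local Notation mu := (lebesgue_tuple R d).

(** Abstracts the two cases of the argument: the unit cube with a realization of
    the coefficient, and a patch with a reference coefficient. *)
Record elliptic (D : set 'rV[R]_d) (A : 'rV[R]_d -> R) (al be : R) : Prop :=
  Elliptic {
  elliptic_closed : closed D;
  elliptic_measurable : measurable (@point_of R d @^-1` D);
  elliptic_finite : (mu (@point_of R d @^-1` D) < +oo)%E;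
  elliptic_coef : measurable_fun (@point_of R d @^-1` D) (A \o @point_of R d);
  elliptic_gt0 : 0 < al;
  elliptic_bounds : ae_on D (fun x => al <= A x <= be)
}.

Definition energy_density (A : 'rV[R]_d -> R) u v x : R := A x *
  \sum_(i < d) 'D_(delta_mx 0 i) u x * 'D_(delta_mx 0 i) v x.

Section elliptic_energy.
Variables (D : set 'rV[R]_d) (A : 'rV[R]_d -> R) (al be : R) (n : nat).
Hypotheses (ell : elliptic D A al be) (n_gt0 : (0 < n)%N).

Let PD := @point_of R d @^-1` D.

(** A null set off which the coefficient obeys its bounds and Q1 functions are
    differentiable. *)
Let exceptional_set : exists N, [/\ measurable N, mu N = 0 &
  forall t, ~ N t -> ~ skeleton n (point_of t) /\
    (PD t -> al <= A (point_of t) <= be)].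
Proof.
have [N [mN N0 sN]] := elliptic_bounds ell.
have mS := @measurable_skeleton R d n.
exists (N `|` @point_of R d @^-1` skeleton n); split.
- exact: measurableU.
- apply: null_set_setU => //; exact: skeleton_null.
- move=> t /not_orP[Nt St]; split => //.
  by move=> Dt; apply: contrapT => h; apply: Nt; apply: sN => /= /(_ Dt).
Qed.

Let density_integrable N u v : measurable N -> mu N = 0 ->
  (forall t, ~ N t -> ~ skeleton n (point_of t) /\
    (PD t -> al <= A (point_of t) <= be)) ->
  Q1_space n u -> Q1_space n v ->
  mu.-integrable (PD `\` N) (EFin \o (energy_density A u v \o @point_of R d)).
Proof.
move=> mN N0 hN hu hv.
have mD := elliptic_measurable ell.
have mDN : measurable (PD `\` N) by exact: measurableD.
have /choice[G hG] : forall i, exists G : 'rV[R]_d -> R,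
    [/\ measurable_fun setT (G \o @point_of R d),
    exists B, forall x, `|G x| <= B &
    forall x, ~ skeleton n x -> is_derive x (delta_mx 0 i) u (G x)].
  by move=> i; exact: Q1_gradient.
have /choice[H hH] : forall i, exists G : 'rV[R]_d -> R,
    [/\ measurable_fun setT (G \o @point_of R d),
    exists B, forall x, `|G x| <= B &
    forall x, ~ skeleton n x -> is_derive x (delta_mx 0 i) v (G x)].
  by move=> i; exact: Q1_gradient.
(* A measurable and bounded replacement of the density off [N]. *)
pose g t := A (point_of t) * \sum_(i <- index_enum 'I_d)
  G i (point_of t) * H i (point_of t).
have gE t : (PD `\` N) t -> energy_density A u v (point_of t) = g t.
  move=> [_ /hN[St _]]; rewrite /energy_density /g; congr (_ * _).
  apply: eq_bigr => i _; have [_ _ dG] := hG i; have [_ _ dH] := hH i.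
  by rewrite (is_deriveE (dG _ St)) (is_deriveE (dH _ St)).
have : mu.-integrable (PD `\` N) (EFin \o g).
  apply: measurable_bounded_integrable => //.
  - apply: le_lt_trans (elliptic_finite ell).
    by apply: le_measure; rewrite ?inE//; exact: subDsetl.
  - apply: measurable_funM.
      by apply: measurable_funS (elliptic_coef ell) => //; exact: subDsetl.
    apply: measurable_sum => i; have [mG _ _] := hG i; have [mH _ _] := hH i.
    by apply: measurable_funTS; exact: measurable_funM.
  have /choice[B hB] : forall i, exists B, forall x, `|G i x| <= B.
    by move=> i; have [_] := hG i.
  have /choice[B' hB'] : forall i, exists B, forall x, `|H i x| <= B.
    by move=> i; have [_] := hH i.
  exists (be * \sum_i B i * B' i); split; first exact: num_real.
  move=> M hM t [Dt Nt]; apply: le_trans (ltW hM).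
  have /andP[h1 h2] := (hN t Nt).2 Dt; have al0 := elliptic_gt0 ell.
  rewrite normrM; apply: ler_pM => //.
    by rewrite ger0_norm// ltW//; exact: lt_le_trans h1.
  apply: le_trans (ler_norm_sum _ _ _) _; apply: ler_sum => i _.
  by rewrite normrM; apply: ler_pM.
by apply: eq_integrable => // t; rewrite inE => /gE /= ->.
Qed.

Let energyE N u v : measurable N -> mu N = 0 ->
  energy D A u v =
  \int[mu]_(t in PD `\` N) energy_density A u v (point_of t).
Proof. by move=> mN N0; rewrite /energy /integral_on /Rintegral (integral_setD_null _ _ mN N0). Qed.

Lemma energyC u v : energy D A u v = energy D A v u.
Proof.
rewrite /energy /integral_on; apply: eq_Rintegral => t _.
by congr (_ * _); apply: eq_bigr => i _; rewrite mulrC.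
Qed.

(** Differentiability holds off the exceptional set only, where all three
    densities are integrable. *)
Lemma energy_linear w : Q1_space n w -> linear_on (Q1_space n) (energy D A ^~ w).
Proof.
move=> hw a u v hu hv; have [N [mN N0 hN]] := exceptional_set.
rewrite !(energyE _ _ mN N0).
have mD := elliptic_measurable ell.
have mDN : measurable (PD `\` N) by exact: measurableD.
have iu := density_integrable mN N0 hN hu hw.
have iv := density_integrable mN N0 hN hv hw.
rewrite -RintegralZl// -RintegralD//; last exact: (integrableZl mDN a iu).
apply: eq_Rintegral => t; rewrite inE => -[Dt /hN[St _]].
rewrite /energy_density mulrCA -mulrDr; congr (_ * _).
rewrite mulr_sumr -big_split/=; apply: eq_bigr => i _.
have [G [_ _ /(_ _ St) dG]] := Q1_gradient i n_gt0 hu.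
have [H [_ _ /(_ _ St) dH]] := Q1_gradient i n_gt0 hv.
rewrite (is_deriveE (is_deriveD (is_deriveZ a dG) dH)).
by rewrite (is_deriveE dG) (is_deriveE dH) mulrDl mulrA.
Qed.

(** Zero energy makes the gradient vanish almost everywhere on [D]; off [D] it
    vanishes because [u] does and [D] is closed. *)
Lemma energy_gt0 u : (0 < d)%N -> Q1_space n u ->
  (forall x, ~ D x -> u x = 0) -> u <> 0 -> 0 < energy D A u u.
Proof.
move=> d0 hu uD u0; have [N [mN N0 hN]] := exceptional_set.
have mD := elliptic_measurable ell.
have mDN : measurable (PD `\` N) by exact: measurableD.
have al0 := elliptic_gt0 ell.
pose f := energy_density A u u \o @point_of R d.
have int_f : mu.-integrable (PD `\` N) (EFin \o f).
  exact: density_integrable.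
have f0 t : (PD `\` N) t -> 0 <= f t.
  move=> [Dt /hN[_ /(_ Dt)/andP[hA _]]]; rewrite /f /= /energy_density.
  apply: mulr_ge0; first by lra.
  by apply: sumr_ge0 => i _; rewrite -expr2 sqr_ge0.
rewrite (energyE _ _ mN N0) lt_def; apply/andP; split; last exact: Rintegral_ge0.
apply/eqP => E0; apply: u0; pose i : 'I_d := Ordinal d0.
apply: (Q1_eq0 (i := i) n_gt0 hu).
have : (\int[mu]_(t in PD `\` N) `|(EFin \o f) t| = 0)%E.
  rewrite -[RHS](_ : (\int[mu]_(t in PD `\` N) (EFin \o f) t)%E = _); last first.
    by rewrite -[LHS]fineK ?integrable_fin_num// -[fine _]/(Rintegral _ _ _) E0.
  by apply: eq_integral => t; rewrite inE => /f0 ft /=; rewrite ger0_norm.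
move=> /(ae_eq_integral_abs mu mDN (measurable_int mu int_f)) ae_f0.
have ae_N : {ae mu, forall t, ~ N t} by exists N; split => // t /contrapT.
apply: filterS2 ae_f0 ae_N => t ft Nt.
have [Dt|Dt] := pselect (D (point_of t)); last first.
  exact: is_deriveE (is_derive_off_closed _ (elliptic_closed ell) uD Dt).
have /andP[hA _] := (hN t Nt).2 Dt.
have [] := ft (conj Dt Nt); rewrite /f /= /energy_density => /eqP.
rewrite mulf_eq0 gt_eqF/=; last by lra.
rewrite psumr_eq0 => [/allP/(_ i)|j _]; last by rewrite -expr2 sqr_ge0.
by rewrite mem_index_enum => /(_ isT); rewrite /= mulf_eq0 orbb => /eqP.
Qed.

Lemma energy_inner_product W : (0 < d)%N -> W `<=` Q1_space n ->
  (forall u, W u -> forall x, ~ D x -> u x = 0) ->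
  inner_product_on W (energy D A).
Proof.
move=> d0 WQ WD; split; first by move=> u v _ _; exact: energyC.
  by move=> w Ww a u v Wu Wv; apply: energy_linear; exact: WQ.
by move=> u Wu; apply: energy_gt0 => //; [exact: WQ|exact: WD].
Qed.

End elliptic_energy.
End energy_form.

(** * Symmetric operators and their spectrum *)

Section symmetric_operators.
Context {R : realType} {d : nat}.
Local Notation fct := ('rV[R]_d -> R).
Implicit Types (V W : set fct) (a b : fct -> fct -> R) (S T : fct -> fct).

Definition symmetric_on V a T : Prop :=
  (forall u, V u -> V (T u)) /\ forall u v, V u -> V v -> a (T u) v = a u (T v).

Lemma symmetric_on_sum V a (I : finType) (T : I -> fct -> fct) :
  subspace_of V -> inner_product_on V a -> (forall i, symmetric_on V a (T i)) ->
  symmetric_on V a (fun u => \sum_i T i u).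
Proof.
move=> sV [sa la _] hT; split => [u Vu|u v Vu Vv].
  by apply: subspace_sum => // i; exact: (hT i).1.
rewrite (linear_on_sum _ sV (la _ Vv)); last by move=> i; exact: (hT i).1.
rewrite [RHS]sa//; last by apply: subspace_sum => // i; exact: (hT i).1.
rewrite (linear_on_sum _ sV (la _ Vu)); last by move=> i; exact: (hT i).1.
apply: eq_bigr => i _; rewrite (hT i).2// sa//; exact: (hT i).1.
Qed.

Lemma symmetric_onD V a S T :
  subspace_of V -> inner_product_on V a ->
  symmetric_on V a S -> symmetric_on V a T ->
  symmetric_on V a (fun u => S u + T u).
Proof.
move=> sV [sa la _] [VS hS] [VT hT]; split => [u Vu|u v Vu Vv].
  by apply: subspaceD => //; [exact: VS|exact: VT].
have [VSu VTu VSv VTv] := And4 (VS _ Vu) (VT _ Vu) (VS _ Vv) (VT _ Vv).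
rewrite (linear_onD (la _ Vv))// [RHS]sa//; last exact: subspaceD.
by rewrite (linear_onD (la _ Vu))// hS// hT// (sa u)// (sa u).
Qed.

Lemma symmetric_onZ V a (c : R) T :
  subspace_of V -> inner_product_on V a -> symmetric_on V a T ->
  symmetric_on V a (fun u => c *: T u).
Proof.
move=> sV [sa la _] [VT hT]; split => [u Vu|u v Vu Vv].
  by apply: subspaceZ => //; exact: VT.
have [VTu VTv] := conj (VT _ Vu) (VT _ Vv).
rewrite (linear_onZ _ sV (la _ Vv))// [RHS]sa//; last exact: subspaceZ.
by rewrite (linear_onZ _ sV (la _ Vu))// hT// (sa u).
Qed.

Lemma galerkinP W s b (g : fct -> R) :
  subspace_of W -> (forall v, W v -> spanned_by s v) ->
  inner_product_on W b -> linear_on W g ->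
  W (galerkin W b g) /\ forall w, W w -> b (galerkin W b g) w = g w.
Proof.
move=> sW Ws ib lg.
exact: (xgetPex 0 (riesz_representation sW Ws ib lg)).
Qed.

(** Whatever inner product [b] defines the local problem, the local solution
    operator applied to [a u] is [a]-symmetric, because
    [a (T u) v = b (T v) (T u)]. *)
Lemma galerkin_symmetric V W s a b :
  inner_product_on V a -> W `<=` V -> subspace_of W ->
  (forall v, W v -> spanned_by s v) -> inner_product_on W b ->
  symmetric_on V a (fun u => galerkin W b (a u)).
Proof.
move=> [sa la _] WV sW Ws ib.
have lin u : V u -> linear_on W (a u).
  move=> Vu c v w Wv Ww; have [Vv Vw] := conj (WV _ Wv) (WV _ Ww).
  have Vcvw : V (c *: v + w) by apply: WV; case: sW => _; apply.
  by rewrite sa// (la _ Vu)// (sa v)// (sa w).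
have spec u Vu := galerkinP sW Ws ib (lin u Vu).
have key u v : V u -> V v ->
    a (galerkin W b (a u)) v = b (galerkin W b (a v)) (galerkin W b (a u)).
  move=> Vu Vv; have [Wu _] := spec u Vu; have [_ hv] := spec v Vv.
  by rewrite hv// sa//; exact: WV.
split => [u Vu|u v Vu Vv]; first by apply: WV; have [] := spec u Vu.
have [[Wu _] [Wv _]] := conj (spec u Vu) (spec v Vv).
have [sb _ _] := ib.
by rewrite key// sb// -key// sa//; exact: WV.
Qed.

(** Taking real and imaginary parts of [a (T f) f] for [f = u + i v]: the first
    is a Rayleigh quotient, the second vanishes by symmetry. *)
Lemma symmetric_spectrum V a T (c1 c2 : R) :
  subspace_of V -> inner_product_on V a -> symmetric_on V a T ->
  (forall v, V v -> c1 * a v v <= a (T v) v <= c2 * a v v) ->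
  spectrum V T `<=` [set (t%:C)%C | t in `[c1, c2]].
Proof.
move=> sV [sa la pa] [VT hT] bnd [x y] [u [v [Vu Vv uv0 /= Tu Tv]]].
have a_ge0 w : V w -> 0 <= a w w.
  move=> Vw; have [->|w0] := pselect (w = 0); last exact/ltW/pa.
  by rewrite (linear_on0 sV (la _ _))//; case: sV.
have [auu avv] := conj (a_ge0 _ Vu) (a_ge0 _ Vv).
have N0 : 0 < a u u + a v v.
  by case: uv0 => [/(pa _ Vu)|/(pa _ Vv)] h; [exact: ltr_pwDl|exact: ltr_pwDr].
have [bu bv] := conj (bnd _ Vu) (bnd _ Vv).
have VZ c w : V w -> V (c *: w) by exact: subspaceZ.
have aTu w : V w -> a (T u) w = x * a u w - y * a v w.
  move=> Vw; rewrite Tu (linear_onB (la _ Vw)); [|exact: VZ|exact: VZ].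
  by rewrite !(linear_onZ _ sV (la _ Vw))//.
have aTv w : V w -> a (T v) w = y * a u w + x * a v w.
  move=> Vw; rewrite Tv (linear_onD (la _ Vw)); [|exact: VZ|exact: VZ].
  by rewrite !(linear_onZ _ sV (la _ Vw))//.
have := hT _ _ Vu Vv; rewrite [RHS]sa//; last exact: VT.
rewrite aTu// aTv// (sa v u)// => E.
have y0 : y = 0.
  have : y * (a u u + a v v) = 0 by lra.
  by move/eqP; rewrite mulf_eq0 (gt_eqF N0) orbF => /eqP.
exists x; last by rewrite y0.
move: bu bv; rewrite aTu// aTv// y0 !mul0r subr0 add0r.
move=> /andP[b1 b2] /andP[b3 b4].
rewrite /= in_itv/= -(ler_pM2r N0) -[x <= c2](ler_pM2r N0).
by apply/andP; split; lra.
Qed.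

(** If there is no eigenvalue then [sup] and [inf] are both zero, and so is their
    quotient. *)
Lemma condition_number_le V T (c1 c2 : R) : 0 < c1 -> 0 <= c2 ->
  spectrum V T `<=` [set (t%:C)%C | t in `[c1, c2]] ->
  condition_number V T <= c2 / c1.
Proof.
move=> c10 c20 hS; rewrite /condition_number.
set E := [set t | _].
have hE t : E t -> c1 <= t <= c2.
  by move=> /hS[t' /= ht' [<-]]; move: ht'; rewrite in_itv.
have [->|/set0P E0] := eqVneq E set0.
  by rewrite sup0 mul0r divr_ge0// ltW.
have sE : sup E <= c2 by apply: ge_sup => // t /hE/andP[].
have iE : c1 <= inf E by apply: lb_le_inf => // t /hE/andP[].
have iE0 : 0 < inf E by exact: lt_le_trans iE.
apply: ler_pM => //.
- have [t Et] := E0; have /andP[h _] := hE _ Et.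
  apply: le_trans (_ : t <= _); first by rewrite (le_trans (ltW c10)).
  by apply: ub_le_sup => //; exists c2 => s /hE/andP[].
- by rewrite invr_ge0 ltW.
- by rewrite lef_pV2// posrE.
Qed.

End symmetric_operators.

(** * The two preconditioned operators *)

Section model_analysis.
Context {R : realType} {d : nat} {M : model R d}.
Hypothesis hM : standing M.
Implicit Types (x : 'rV[R]_d) (u v w : 'rV[R]_d -> R).
Local Notation leb := (lebesgue_tuple R d).
Local Notation Omega := (@cube R d 1).

Let d_gt0 : (0 < d)%N. Proof. by case/andP: (dim_range hM). Qed.
Let nH_gt0 : (0 < nH M)%N. Proof. by case/andP: (mesh_range hM). Qed.
Let nh_gt0 : (0 < nh M)%N.
Proof. by case/andP: (mesh_range hM) => h; exact: ltn_trans. Qed.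
Let eps_gt0 : 0 < eps M.
Proof.
by case/andP: (eps_range hM) => h _; apply: lt_le_trans h; rewrite invr_gt0 ltr0n.
Qed.

Let Vh_lin : subspace_of (Vh M) := Q1_subspace _.

Lemma measurable_rescaled (f : 'rV[R]_d -> R) (s : R) (c : 'rV[R]_d) :
  measurable_fun setT (f \o @point_of R d) ->
  measurable_fun setT (fun t => f (s *: point_of t + c)).
Proof.
move=> mf.
have -> : (fun t => f (s *: point_of t + c)) =
    (f \o @point_of R d) \o affine_tuple s c.
  by apply/funext => t /=; rewrite point_of_affine.
by apply: measurableT_comp => //; exact: measurable_affine_tuple.
Qed.

Lemma defect_cellE j x :
  defect_cell M j x <-> Qcell M ((eps M)^-1 *: x - zvec R j).
Proof.
split => [[q Qq <-]|Qx].
  by rewrite scalerA mulVf ?gt_eqF// scale1r addrAC subrr add0r.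
exists ((eps M)^-1 *: x - zvec R j) => //.
by rewrite addrC subrK scalerA mulfV ?gt_eqF// scale1r.
Qed.

Lemma measurable_Aeps (c : 'rV[R]_d) :
  measurable_fun setT (fun t => Aeps M (point_of t + c)).
Proof.
under eq_fun do rewrite /Aeps scalerDr.
exact: measurable_rescaled (Aper_measurable hM).
Qed.

Lemma measurable_Beps (c : 'rV[R]_d) :
  measurable_fun setT (fun t => Beps M (point_of t + c)).
Proof.
under eq_fun do rewrite /Beps scalerDr.
exact: measurable_rescaled (Bper_measurable hM).
Qed.

Lemma measurable_defect_indic j (c : 'rV[R]_d) :
  measurable_fun setT
    (fun t => \1_(defect_cell M j) (point_of t + c) : R).
Proof.
pose c' := (eps M)^-1 *: c - zvec R j.
have mQ : measurable (affine_tuple (eps M)^-1 c' @^-1`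
    (@point_of R d @^-1` Qcell M)).
  rewrite -[X in measurable X]setTI.
  by apply: measurable_affine_tuple => //; exact: (Qcell_measurable hM).
rewrite (_ : (fun t => _) = \1_(affine_tuple (eps M)^-1 c' @^-1`
    (@point_of R d @^-1` Qcell M))); first exact: measurable_indic.
apply/funext => t; rewrite !indicE; congr (_%:R).
congr nat_of_bool; apply/idP/idP; rewrite !inE /= point_of_affine.
  by move/defect_cellE; rewrite scalerDr addrA.
by move=> h; apply/defect_cellE; rewrite scalerDr -addrA.
Qed.

Lemma measurable_Aloc k l :
  measurable_fun setT (@Aloc R d M k l \o @point_of R d).
Proof.
apply: measurable_funD; first exact: measurable_Aeps.
case: (unlift ord0 l) => [l'|]; last exact: measurable_cst.
by apply: measurable_funM; [exact: measurable_defect_indic|exact: measurable_Beps].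
Qed.

Lemma ae_on_setT (P : 'rV[R]_d -> Prop) :
  ae_on setT P -> {ae leb, forall t, P (point_of t)}.
Proof.
by move=> [N [mN N0 sN]]; exists N; split => // t nP; apply: sN => /(_ Logic.I).
Qed.

(** At each point the reference coefficient takes either the value of [Aper] or
    that of [Aper + Bper] at the rescaled point. *)
Lemma Aloc_bounds k l (D : set 'rV[R]_d) :
  ae_on D (fun x => alpha M <= @Aloc R d M k l x <= beta M).
Proof.
pose c := (eps M)^-1 *: - @patch_offset R d M k.
have ie : 0 < (eps M)^-1 by rewrite invr_gt0.
have hA : {ae leb, forall t,
    alpha M <= Aper M ((eps M)^-1 *: point_of t + c) <= beta M}.
  apply: (@ae_affine _ _ _ c (fun x => alpha M <= Aper M x <= beta M)) => //.
  exact: ae_on_setT (Aper_bounds hM).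
have hB : {ae leb, forall t,
    alpha M <= Aper M ((eps M)^-1 *: point_of t + c) +
               Bper M ((eps M)^-1 *: point_of t + c) <= beta M}.
  apply: (@ae_affine _ _ _ c
    (fun x => alpha M <= Aper M x + Bper M x <= beta M)) => //.
  exact: ae_on_setT (ABper_bounds hM).
apply: filterS2 hA hB => t hA hB _.
rewrite /Aloc /Aref /Aeps /Beps scalerDr -/c.
case: (unlift ord0 l) => [l'|]; last by rewrite addr0.
by rewrite indicE; case: (_ \in _); rewrite ?mul1r// mul0r addr0.
Qed.

(** The defect cells that meet the unit cube are indexed by integer vectors with
    entries between [-1] and [nh], because [1 / eps <= nh]; hence the defect sum
    is finite there. *)
Lemma defect_cell_index j x : Omega x -> defect_cell M j x ->
  exists f : {ffun 'I_d -> 'I_(nh M).+2}, j = \row_i ((f i)%:Z - 1).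
Proof.
move=> hx [q Qq xE].
have hq := Qcell_unit hM Qq.
have nh0 : 0 < (nh M)%:R :> R by rewrite ltr0n.
have bnd i : -1 <= j 0 i <= (nh M)%:Z.
  have /andP[x0 x1] := hx i; have /andP[q0 q1] := hq i.
  have /andP[he _] := eps_range hM.
  move: x0 x1; rewrite -xE !mxE => x0 x1.
  have r0 : 0 <= (j 0 i)%:~R + q 0 i by rewrite -(pmulr_rge0 _ eps_gt0).
  have r1 : (j 0 i)%:~R + q 0 i <= (nh M)%:R.
    rewrite -(ler_pM2l eps_gt0); apply: le_trans x1 _.
    by rewrite -ler_pdivrMr// div1r.
  apply/andP; split; rewrite -(ler_int R); last by rewrite -[leRHS]/((nh M)%:R); lra.
  by rewrite mulrN1z; lra.
have lt_j i : (absz (j 0%R i + 1)%R < (nh M).+2)%N.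
  by have /andP[h1 h2] := bnd i; lia.
exists [ffun i => Ordinal (lt_j i)]; apply/rowP => i; rewrite mxE ffunE /=.
by have /andP[h1 h2] := bnd i; lia.
Qed.

Lemma measurable_coef :
  measurable_fun (@point_of R d @^-1` Omega) (coef M \o @point_of R d).
Proof.
(* The sites outside the finite set [J] contribute nothing on the cube. *)
pose J := defect_sites M `&`
  range (fun f : {ffun 'I_d -> 'I_(nh M).+2} => \row_i ((f i)%:Z - 1) : 'rV[int]_d).
have finJ : finite_set J by apply: finite_setIr; exact: finite_image.
pose g t := Aeps M (point_of t + 0) + \sum_(j <- fset_set J)
  (defect M j)%:R * \1_(defect_cell M j) (point_of t + 0) * Beps M (point_of t + 0).
apply: (@eq_measurable_fun _ _ _ _ _ g); last first.
  apply: measurable_funTS; apply: measurable_funD; first exact: measurable_Aeps.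
  apply: measurable_sum => j; apply: measurable_funM; last exact: measurable_Beps.
  by apply: measurable_funM => //; exact: measurable_defect_indic.
move=> t; rewrite inE /= => ht; rewrite /g addr0 /coef; congr (_ + _).
rewrite -fsbig_finite//; apply: fsbig_widen; first by move=> j [].
move=> j [Sj nJ]; rewrite /= indicE memNset ?mulr0 ?mul0r// => cj.
apply: nJ; split => //; have [f ->] := defect_cell_index ht cj.
by exists f.
Qed.

Lemma elliptic_Omega : elliptic Omega (coef M) (alpha M) (beta M).
Proof.
split.
- by rewrite cubeE; exact: closed_closed_box.
- by rewrite cubeE; exact: measurable_closed_box.
- by rewrite cubeE; exact: lebesgue_closed_box_lty.
- exact: measurable_coef.
- by case/andP: (alpha_beta hM).
- exact: coef_bounds hM.
Qed.

(** The nodal function is nonzero exactly on the open box of half-width [1 / nH]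
    around its vertex. *)
Lemma patch_closed_box k : @Defs.patch R d M k =
  closed_box (@patch_offset R d M k)
    (\row_i ((k i).+2%:R / (nH M)%:R)).
Proof.
have n0 : 0 < (nH M)%:R :> R by rewrite ltr0n.
have nodal_neq0 : [set x | @nodal R d M k x != 0] =
    open_box (@patch_offset R d M k) (\row_i ((k i).+2%:R / (nH M)%:R)).
  apply/seteqP.
  have E x i : (Num.max 0 (1 - `|(nH M)%:R * x 0 i - (k i).+1%:R|) != 0) =
      (@patch_offset R d M k 0 i < x 0 i < (k i).+2%:R / (nH M)%:R).
    rewrite !mxE ltr_pdivrMr// ltr_pdivlMr// [x 0 i * _]mulrC.
    rewrite -[(k i).+2]addn2 -[(k i).+1]addn1 !natrD.
    have [h|h] := leP 1 `|(nH M)%:R * x 0 i - ((k i)%:R + 1)|.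
      rewrite max_l ?eqxx ?subr_le0//; apply/esym/negbTE/negP => /andP[h1 h2].
      by move: h; rewrite leNgt ltr_norml; apply/negP/negPn/andP; split; lra.
    rewrite max_r ?subr_ge0 ?(ltW h)// gt_eqF ?subr_gt0//.
    by move: h; rewrite ltr_norml => /andP[h1 h2]; apply/esym/andP; split; lra.
  split => x /=.
    by move=> /prodf_neq0 h i; rewrite mxE -E; exact: h.
  by move=> h; apply/prodf_neq0 => i _; rewrite E; have := h i; rewrite !mxE.
rewrite /Defs.patch nodal_neq0.
apply: (closure_open_box (c := \row_i ((k i).+1%:R / (nH M)%:R))) => i.
by rewrite !mxE !ltr_pM2r ?invr_gt0// !ltr_nat !ltnS !leqnn.
Qed.

Lemma elliptic_patch k l :
  elliptic (@Defs.patch R d M k) (@Aloc R d M k l) (alpha M) (beta M).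
Proof.
split.
- by rewrite patch_closed_box; exact: closed_closed_box.
- by rewrite patch_closed_box; exact: measurable_closed_box.
- by rewrite patch_closed_box; exact: lebesgue_closed_box_lty.
- by apply: measurable_funTS; exact: measurable_Aloc.
- by case/andP: (alpha_beta hM).
- exact: Aloc_bounds.
Qed.

Lemma Vh_off u : Vh M u -> forall x, ~ Omega x -> u x = 0.
Proof. by case. Qed.

Lemma aform_inner_product : inner_product_on (Vh M) (aform M).
Proof. exact: (energy_inner_product elliptic_Omega nh_gt0 d_gt0 _ Vh_off). Qed.

Lemma VH_Vh : @VH R d M `<=` Vh M.
Proof. exact: (Q1_refine nh_gt0 (mesh_nested hM)). Qed.

Lemma Vloc_Vh k : @Vloc R d M k `<=` Vh M.
Proof. by move=> u []. Qed.

Lemma Vloc_subspace k : subspace_of (@Vloc R d M k).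
Proof.
have [V0 VL] := Vh_lin; split; first by split.
move=> a u v [Vu u0] [Vv v0]; split; first exact: VL.
by move=> x hx; rewrite -[LHS]/(a * u x + v x) u0// v0// mulr0 addr0.
Qed.

Let Vh_spanned u : Vh M u -> spanned_by (codom (@Q1_monomial R d (nh M))) u.
Proof. exact: Q1_spanned. Qed.

Let sub_inner W : W `<=` Vh M -> inner_product_on W (aform M).
Proof.
have [sa la pa] := aform_inner_product; move=> WV; split.
- by move=> u v /WV ? /WV ?; exact: sa.
- by move=> w /WV Vw a u v /WV Vu /WV Vv; exact: la.
- by move=> w /WV; exact: pa.
Qed.

Let coarse_symmetric : symmetric_on (Vh M) (aform M) (fun u => B0 M (Lop M u)).
Proof.
apply: (galerkin_symmetric aform_inner_product VH_Vh (Q1_subspace _)).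
  by move=> v /VH_Vh; exact: Vh_spanned.
exact: (sub_inner VH_Vh).
Qed.

Lemma Pex_symmetric : symmetric_on (Vh M) (aform M) (Pex M).
Proof.
apply: (symmetric_onD Vh_lin aform_inner_product coarse_symmetric).
apply: (symmetric_on_sum (T := fun k u => Bi k (Lop M u)) Vh_lin aform_inner_product).
move=> k; apply: (galerkin_symmetric aform_inner_product (@Vloc_Vh k) (Vloc_subspace k)).
  by move=> v /Vloc_Vh; exact: Vh_spanned.
exact: (sub_inner (@Vloc_Vh k)).
Qed.

(** The reference solvers are symmetric for [aform] although each of them inverts
    the energy form of another coefficient, and the weights [mu], which may be
    negative, preserve symmetry. *)
Lemma Ptilde_symmetric : symmetric_on (Vh M) (aform M) (Ptilde M).
Proof.
apply: (symmetric_onD Vh_lin aform_inner_product coarse_symmetric).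
apply: (symmetric_on_sum (T := fun k u => Btilde_loc k (Lop M u)) Vh_lin aform_inner_product).
move=> k.
apply: (symmetric_on_sum (T := fun l u => mu k l *: Bref k l (Lop M u)) Vh_lin aform_inner_product).
move=> l; apply: (symmetric_onZ _ Vh_lin aform_inner_product).
apply: (galerkin_symmetric aform_inner_product (@Vloc_Vh k) (Vloc_subspace k)).
  by move=> v /Vloc_Vh; exact: Vh_spanned.
apply: (energy_inner_product (elliptic_patch k l) nh_gt0 d_gt0 (@Vloc_Vh k)).
by move=> u [].
Qed.

Lemma anorm_sqr v : Vh M v -> anorm M v ^+ 2 = aform M v v.
Proof.
move=> Vv; rewrite sqr_sqrtr//; have [_ la pa] := aform_inner_product.
have [->|v0] := pselect (v = 0); last exact/ltW/pa.
by rewrite (linear_on0 Vh_lin (la _ _))//; case: Vh_lin.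
Qed.

(** The supremum is over an empty set, and equal to [-oo], exactly when the finite
    element space is trivial. *)
Lemma eta_fin_num v (c : R) : Vh M v -> v <> 0 -> (eta M < c%:E)%E ->
  eta M \is a fin_num /\ 0 <= fine (eta M).
Proof.
move=> Vv v0 hc.
have h0 : (0 <= eta M)%E.
  apply: le_trans (_ : (`|aform M (Ptilde M v - Pex M v) v| / anorm M v ^+ 2)%:E <= _)%E.
    by rewrite lee_fin divr_ge0// sqr_ge0.
  by apply: ereal_sup_ubound; exists v.
split; last exact: fine_ge0.
by rewrite ge0_fin_numE//; apply: lt_trans hc _; exact: ltry.
Qed.

Lemma Ptilde_perturbation v : Vh M v -> eta M \is a fin_num ->
  `|aform M (Ptilde M v) v - aform M (Pex M v) v|
    <= fine (eta M) * anorm M v ^+ 2.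
Proof.
move=> Vv he; have [_ la pa] := aform_inner_product.
have [VP VPt] := conj (Pex_symmetric.1 _ Vv) (Ptilde_symmetric.1 _ Vv).
rewrite -(linear_onB (la _ Vv))//.
have [v0|v0] := pselect (v = 0).
  rewrite anorm_sqr// v0.
  have [sa _ _] := aform_inner_product.
  have V0 : Vh M 0 by case: Vh_lin.
  have a0 w : Vh M w -> aform M w 0 = 0.
    by move=> Vw; rewrite sa//; exact: (linear_on0 Vh_lin (la _ Vw)).
  by rewrite !a0 ?normr0 ?mulr0// -v0; exact: subspaceB.
have p0 : 0 < anorm M v ^+ 2 by rewrite anorm_sqr//; exact: pa.
rewrite -ler_pdivrMr// -lee_fin fineK//.
by apply: ereal_sup_ubound; exists v.
Qed.

End model_analysis.

Unset Implicit Arguments.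

Theorem theorem4p5 (R : realType) (d : nat) (M : model R d) (hM : standing M)
    (C1 C2 : R) (hC1 : 0 < C1) (hC2 : 0 < C2)
    (hP : forall v : 'rV[R]_d -> R, Vh M v ->
       C1 * anorm M v ^+ 2 <= aform M (Pex M v) v <= C2 * anorm M v ^+ 2)
    (heta : (eta M < C1%:E)%E) :
  [/\ forall v : 'rV[R]_d -> R, Vh M v ->
        (C1 - fine (eta M)) * anorm M v ^+ 2 <= aform M (Ptilde M v) v
          <= (C2 + fine (eta M)) * anorm M v ^+ 2,
      spectrum (Vh M) (Ptilde M) `<=`
        [set (t%:C)%C | t in `[C1 - fine (eta M), C2 + fine (eta M)]] &
      condition_number (Vh M) (Ptilde M)
        <= (C2 + fine (eta M)) / (C1 - fine (eta M))].
Proof.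
have ia := aform_inner_product hM.
have sV : subspace_of (Vh M) := Q1_subspace _.
have bounds v : Vh M v ->
    (C1 - fine (eta M)) * anorm M v ^+ 2 <= aform M (Ptilde M v) v
      <= (C2 + fine (eta M)) * anorm M v ^+ 2.
  move=> Vv; have /andP[b1 b2] := hP _ Vv.
  have [v0|v0] := pselect (v = 0).
    have [sa la _] := ia; have [V0 _] := sV.
    rewrite anorm_sqr// v0 (linear_on0 sV (la _ V0)) !mulr0.
    rewrite sa//; last by apply: (Ptilde_symmetric hM).1.
    rewrite (linear_on0 sV (la _ _)) ?lexx//.
    exact: (Ptilde_symmetric hM).1.
  have [fe _] := eta_fin_num Vv v0 heta.
  have := Ptilde_perturbation hM Vv fe.
  rewrite ler_distl !mulrDl mulNr => /andP[h1 h2]; apply/andP; split.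
    by apply: le_trans h1; rewrite lerD2r.
  by apply: le_trans h2 _; rewrite lerD2r.
(* If the space is trivial then [eta] is [-oo], whose [fine] is zero. *)
have [eta_lt eta_ge] : fine (eta M) < C1 /\ - C2 <= fine (eta M).
  have [[v [Vv v0]]|noV] := pselect (exists v, Vh M v /\ v <> 0).
    have [fe e0] := eta_fin_num Vv v0 heta; split; last by lra.
    by rewrite -lte_fin fineK.
  have -> : eta M = -oo%E.
    rewrite /eta (_ : [set _ | _ in _] = set0) ?ereal_sup0//.
    by apply/seteqP; split => // t [v [Vv v0] _]; case: noV; exists v.
  by split => //=; lra.
have spec : spectrum (Vh M) (Ptilde M) `<=`
    [set (t%:C)%C | t in `[C1 - fine (eta M), C2 + fine (eta M)]].
  apply: (symmetric_spectrum sV ia (Ptilde_symmetric hM)) => v Vv.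
  by rewrite -anorm_sqr//; exact: bounds.
split => //; apply: condition_number_le => //; lra.
Qed.
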